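(* Let $(A,m_\bullet)$ be an $A_\infty$-algebra in a monoidal DG category $\mathcal{A}$ (under the standing assumptions below), let $(a,p_\bullet)\in\mathrm{Nod}_\infty\text{-}A$ be a right $A_\infty$-$A$-module, and let $b$ be an object of $\mathcal{A}$. Suppose $f\colon a\to b$ and $g\colon b\to a$ are closed degree $0$ morphisms in $\mathcal{A}$ with $gf=\mathrm{id}_a+dh$ for some degree $-1$ morphism $h\colon a\to a$. Then there exist: (1) a structure $q_\bullet$ of a right $A_\infty$-$A$-module on $b$; (2) a closed degree $0$ morphism of $A_\infty$-$A$-modules $\phi_\bullet\colon(a,p_\bullet)\to(b,q_\bullet)$ with $\phi_1=f$; (3) a closed degree $0$ morphism of $A_\infty$-$A$-modules $\psi_\bullet\colon(b,q_\bullet)\to(a,p_\bullet)$ with $\psi_1=g$; (4) a degree $-1$ morphism of $A_\infty$-$A$-modules $H_\bullet\colon(a,p_\bullet)\to(a,p_\bullet)$ with $H_1=h$, such that $\psi_\bullet\circ\phi_\bullet=\mathrm{id}+d(H_\bullet)$ in $\mathrm{Nod}_\infty\text{-}A$.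
   Context: Twisted complexes: for a DG category $\mathcal{C}$ fully faithfully embedded in a DG category $\mathcal{D}$ with countable direct sums and shifts, a twisted complex $(c_i,\gamma_{ij})$ consists of $c_i\in\mathcal{C}$ ($i\in\mathbb{Z}$) and $\gamma_{ij}\colon c_i\to c_j$ of degree $i-j+1$ with $\sum\gamma_{ij}$ a degree 1 endomorphism of $\bigoplus c_i[-i]$ in $\mathcal{D}$ and $(-1)^jd\gamma_{ij}+\sum_k\gamma_{kj}\gamma_{ik}=0$; morphisms of total degree $n$ have components $f_{kl}\colon c_k\to c'_l$ of degree $n+k-l$, composition is matrix composition and $(df)_{kl}=(-1)^ld f_{kl}+\sum_m\gamma'_{ml}f_{km}-(-1)^n\sum_m f_{ml}\gamma_{km}$. Standing assumptions: $\mathcal{A}$ is a monoidal DG category with a fixed fully faithful monoidal DG embedding into a closed monoidal DG category $\mathcal{B}$ with countable direct sums and shifts which admits convolutions of unbounded twisted complexes; twisted complexes over $\mathcal{A}$ are taken relative to $\mathcal{B}$. $A_\infty$-algebra in $\mathcal{A}$: $A\in\mathcal{A}$ with $m_i\colon A^{\otimes i}\to A$ of degree $2-i$ ($i\ge2$) such that the data with $A^{\otimes(i+1)}$ in position $-i$ ($i\ge0$) and components $A^{\otimes(i+k)}\to A^{\otimes i}$ equal to $(-1)^{(i-1)(k+1)}\sum_{j=0}^{i-1}(-1)^{jk}\mathrm{id}^{\otimes(i-j-1)}\otimes m_{k+1}\otimes\mathrm{id}^{\otimes j}$ ($i,k\ge1$) is a twisted complex. Right $A_\infty$-$A$-module: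 $E\in\mathcal{A}$ with $p_i\colon E\otimes A^{\otimes(i-1)}\to E$ of degree $2-i$ ($i\ge2$) such that $B_\infty(E)$ is a twisted complex, where $B_\infty(E)$ has $E\otimes A^{\otimes i}$ in position $-i$ ($i\ge0$) and components $E\otimes A^{\otimes(i+k-1)}\to E\otimes A^{\otimes(i-1)}$ ($i,k\ge1$) equal to $(-1)^{(i-1)(k+1)}\big(\sum_{j=0}^{i-2}(-1)^{jk}\mathrm{id}^{\otimes(i-j-1)}\otimes m_{k+1}\otimes\mathrm{id}^{\otimes j}+(-1)^{(i-1)k}p_{k+1}\otimes\mathrm{id}^{\otimes(i-1)}\big)$. A degree $j$ morphism $(E,p)\to(F,q)$ is a family $f_i\colon E\otimes A^{\otimes(i-1)}\to F$ of degree $j-i+1$ ($i\ge1$); its bar construction $B_\infty(f)\colon B_\infty(E)\to B_\infty(F)$ has components $(-1)^{j(i-1)}f_{k+1}\otimes\mathrm{id}^{\otimes(i-1)}\colon E\otimes A^{\otimes(i+k-1)}\to F\otimes A^{\otimes(i-1)}$. $\mathrm{Nod}_\infty\text{-}A$ is the DG category of right $A_\infty$-$A$-modules in $\mathcal{A}$ with these morphisms, differential and composition defined so that $B_\infty$ is a faithful DG functor into twisted complexes over $\mathcal{A}$; the identity has $f_1=\mathrm{id}$, $f_{\ge2}=0$. *)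

(* Defs.v *)
From HB Require Import structures.
From mathcomp Require Import all_boot all_algebra.
Set Implicit Arguments. Unset Strict Implicit. Unset Printing Implicit Defensive.
Import GRing.Theory.
Local Open Scope ring_scope.

Definition sgn {V : zmodType} (n : nat) (x : V) : V := if odd n then - x else x.
Definition sgni {V : zmodType} (n : int) (x : V) : V := sgn `|n|%N x.

(* Monoidal DG categories.  Mor X Y is the (total) graded group of morphisms; *)
(* hdeg f n means "f is homogeneous of degree n".                             *)
Record dgdata := DGData {
  Ob : Type;
  Mor : Ob -> Ob -> zmodType;
  hdeg : forall X Y : Ob, Mor X Y -> int -> Prop;
  cmp : forall X Y Z : Ob, Mor Y Z -> Mor X Y -> Mor X Z;
  idm : forall X : Ob, Mor X X;
  dif : forall X Y : Ob, Mor X Y -> Mor X Y;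
  tens : Ob -> Ob -> Ob;
  tensm : forall X X' Y Y' : Ob, Mor X X' -> Mor Y Y' -> Mor (tens X Y) (tens X' Y');
  unitO : Ob;
  assoc : forall X Y Z : Ob, Mor (tens (tens X Y) Z) (tens X (tens Y Z));
  assocV : forall X Y Z : Ob, Mor (tens X (tens Y Z)) (tens (tens X Y) Z);
  lunit : forall X : Ob, Mor (tens unitO X) X;
  lunitV : forall X : Ob, Mor X (tens unitO X);
  runit : forall X : Ob, Mor (tens X unitO) X;
  runitV : forall X : Ob, Mor X (tens X unitO)
}.

Arguments Mor {C} : rename.
Arguments hdeg {C X Y} : rename.
Arguments cmp {C X Y Z} : rename.
Arguments idm {C} : rename.
Arguments dif {C X Y} : rename.
Arguments tens {C} : rename.
Arguments tensm {C X X' Y Y'} : rename.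
Arguments unitO {C} : rename.
Arguments assoc {C} : rename.
Arguments assocV {C} : rename.
Arguments lunit {C} : rename.
Arguments lunitV {C} : rename.
Arguments runit {C} : rename.
Arguments runitV {C} : rename.

Record dg_axioms (C : dgdata) : Prop := {
  hdeg0 : forall (X Y : Ob C) n, hdeg (0 : Mor X Y) n;
  hdegD : forall (X Y : Ob C) (f g : Mor X Y) n, hdeg f n -> hdeg g n -> hdeg (f + g) n;
  hdegN : forall (X Y : Ob C) (f : Mor X Y) n, hdeg f n -> hdeg (- f) n;
  hdeg_uniq : forall (X Y : Ob C) (f : Mor X Y) n n', hdeg f n -> hdeg f n' -> n <> n' -> f = 0;
  compDl : forall (X Y Z : Ob C) (f f' : Mor Y Z) (g : Mor X Y), cmp (f + f') g = cmp f g + cmp f' g;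
  compDr : forall (X Y Z : Ob C) (f : Mor Y Z) (g g' : Mor X Y), cmp f (g + g') = cmp f g + cmp f g';
  compA : forall (W X Y Z : Ob C) (f : Mor Y Z) (g : Mor X Y) (h : Mor W X),
      cmp f (cmp g h) = cmp (cmp f g) h;
  comp1m : forall (X Y : Ob C) (f : Mor X Y), cmp (idm Y) f = f;
  compm1 : forall (X Y : Ob C) (f : Mor X Y), cmp f (idm X) = f;
  hdeg_id : forall X : Ob C, hdeg (idm X) 0;
  hdeg_comp : forall (X Y Z : Ob C) (f : Mor Y Z) (g : Mor X Y) n n',
      hdeg f n -> hdeg g n' -> hdeg (cmp f g) (n + n');
  difD : forall (X Y : Ob C) (f g : Mor X Y), dif (f + g) = dif f + dif g;
  difK : forall (X Y : Ob C) (f : Mor X Y), dif (dif f) = 0;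
  hdeg_dif : forall (X Y : Ob C) (f : Mor X Y) n, hdeg f n -> hdeg (dif f) (n + 1);
  dif_comp : forall (X Y Z : Ob C) (f : Mor Y Z) (g : Mor X Y) n,
      hdeg f n -> dif (cmp f g) = cmp (dif f) g + sgni n (cmp f (dif g));
  tensmDl : forall (X X' Y Y' : Ob C) (f f' : Mor X X') (g : Mor Y Y'),
      tensm (f + f') g = tensm f g + tensm f' g;
  tensmDr : forall (X X' Y Y' : Ob C) (f : Mor X X') (g g' : Mor Y Y'),
      tensm f (g + g') = tensm f g + tensm f g';
  hdeg_tensm : forall (X X' Y Y' : Ob C) (f : Mor X X') (g : Mor Y Y') n n',
      hdeg f n -> hdeg g n' -> hdeg (tensm f g) (n + n');
  tensm11 : forall X Y : Ob C, tensm (idm X) (idm Y) = idm (tens X Y);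
  tensm_comp : forall (X X' X'' Y Y' Y'' : Ob C) (f : Mor X' X'') (g : Mor Y' Y'')
      (h : Mor X X') (k : Mor Y Y') n n', hdeg g n -> hdeg h n' ->
      cmp (tensm f g) (tensm h k) = sgni (n * n') (tensm (cmp f h) (cmp g k));
  dif_tensm : forall (X X' Y Y' : Ob C) (f : Mor X X') (g : Mor Y Y') n,
      hdeg f n -> dif (tensm f g) = tensm (dif f) g + sgni n (tensm f (dif g));
  hdeg_assoc : forall X Y Z : Ob C, hdeg (assoc X Y Z) 0 /\ hdeg (assocV X Y Z) 0;
  hdeg_lunit : forall X : Ob C, hdeg (lunit X) 0 /\ hdeg (lunitV X) 0;
  hdeg_runit : forall X : Ob C, hdeg (runit X) 0 /\ hdeg (runitV X) 0;
  dif_assoc : forall X Y Z : Ob C, dif (assoc X Y Z) = 0 /\ dif (assocV X Y Z) = 0;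
  dif_lunit : forall X : Ob C, dif (lunit X) = 0 /\ dif (lunitV X) = 0;
  dif_runit : forall X : Ob C, dif (runit X) = 0 /\ dif (runitV X) = 0;
  assocK : forall X Y Z : Ob C, cmp (assocV X Y Z) (assoc X Y Z) = idm _ /\
                                cmp (assoc X Y Z) (assocV X Y Z) = idm _;
  lunitK : forall X : Ob C, cmp (lunitV X) (lunit X) = idm _ /\ cmp (lunit X) (lunitV X) = idm _;
  runitK : forall X : Ob C, cmp (runitV X) (runit X) = idm _ /\ cmp (runit X) (runitV X) = idm _;
  assoc_nat : forall (X X' Y Y' Z Z' : Ob C) (f : Mor X X') (g : Mor Y Y') (h : Mor Z Z'),
      cmp (assoc X' Y' Z') (tensm (tensm f g) h) = cmp (tensm f (tensm g h)) (assoc X Y Z);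
  lunit_nat : forall (X X' : Ob C) (f : Mor X X'),
      cmp (lunit X') (tensm (idm unitO) f) = cmp f (lunit X);
  runit_nat : forall (X X' : Ob C) (f : Mor X X'),
      cmp (runit X') (tensm f (idm unitO)) = cmp f (runit X);
  pentagon : forall W X Y Z : Ob C,
      cmp (assoc W X (tens Y Z)) (assoc (tens W X) Y Z) =
      cmp (tensm (idm W) (assoc X Y Z))
           (cmp (assoc W (tens X Y) Z) (tensm (assoc W X Y) (idm Z)));
  triangle : forall X Y : Ob C,
      cmp (tensm (idm X) (lunit Y)) (assoc X unitO Y) = tensm (runit X) (idm Y)
}.

(* bt X n = ((X (x) A) (x) A) ... (x) A  (n copies of A), i.e. X (x) A^{(x)n}; *)
(* in particular A^{(x)(n+1)} = bt A n.                                       *)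
Section Bar.
Variable C : dgdata.
Variable A : Ob C.

Fixpoint bt (X : Ob C) (n : nat) : Ob C :=
  match n with 0 => X | n'.+1 => tens (bt X n') A end.

Fixpoint splitA (X : Ob C) (a c : nat) : Mor (bt X (c + a).+1) (tens (bt X a) (bt A c)) :=
  match c return Mor (bt X (c + a).+1) (tens (bt X a) (bt A c)) with
  | 0 => idm _
  | c'.+1 => cmp (assoc (bt X a) (bt A c') A) (tensm (splitA X a c') (idm A))
  end.

Fixpoint liftn (X Y : Ob C) (n m b : nat) (f : Mor (bt X n) (bt Y m)) :
    Mor (bt X (b + n)) (bt Y (b + m)) :=
  match b return Mor (bt X (b + n)) (bt Y (b + m)) with
  | 0 => f
  | b'.+1 => tensm (liftn b' f) (idm A)
  end.

Definition insx (X : Ob C) (a c : nat) (phi : Mor (bt A c) A) :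
    Mor (bt X (c + a).+1) (bt X a.+1) :=
  cmp (tensm (idm (bt X a)) phi) (splitA X a c).

Definition hcast (X Y : Ob C) (s s' t t' : nat) (e1 : s' = s) (e2 : t' = t)
    (f : Mor (bt X s') (bt Y t')) : Mor (bt X s) (bt Y t) :=
  match e1 in _ = s0 return Mor (bt X s0) (bt Y t) with
  | erefl => match e2 in _ = t0 return Mor (bt X s') (bt Y t0) with
             | erefl => f end end.

(* cast if the lengths agree, 0 otherwise (only used where they agree) *)
Definition tc (X Y : Ob C) (s t s' t' : nat) (f : Mor (bt X s') (bt Y t')) :
    Mor (bt X s) (bt Y t) :=
  match @eqnP s' s, @eqnP t' t with
  | ReflectT e1, ReflectT e2 => hcast e1 e2 f
  | _, _ => 0
  end.

Variable m : forall k : nat, Mor (bt A k) A.   (* m k = m_{k+1} *)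

(* Components of B_oo(X) for a structure p (p k = p_{k+1}):  the component
   from X(x)A^{(x)s} (position -s) to X(x)A^{(x)t} (position -t).  With
   i - 1 = t and k = s - t >= 1 this is
   (-1)^{(i-1)(k+1)} ( sum_{j=0}^{i-2} (-1)^{jk} id^{(x)(i-j-1)} (x) m_{k+1} (x) id^{(x)j}
                       + (-1)^{(i-1)k} p_{k+1} (x) id^{(x)(i-1)} ).
   For X = A and p = m this is exactly the twisted complex defining an
   A_oo-algebra (the last term being the j = i-1 summand). *)
Definition gam (X : Ob C) (p : forall k : nat, Mor (bt X k) X) (s t : nat) :
    Mor (bt X s) (bt X t) :=
  if (t < s)%N then
    sgn (t * (s - t)%N.+1)%N
      (\sum_(j < t)
          sgn (j * (s - t)%N)%N
            (@tc X X s t _ _ (@liftn X X ((s - t)%N + (t.-1 - j)%N)%N.+1 (t.-1 - j)%N.+1 j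
                                  (insx X (t.-1 - j)%N (m (s - t)%N))))
       + sgn (t * (s - t)%N)%N
            (@tc X X s t _ _ (@liftn X X (s - t)%N 0 t (p (s - t)%N : Mor (bt X (s - t)%N) (bt X 0)))))
  else 0.

Definition twisted (X : Ob C) (G : forall s t : nat, Mor (bt X s) (bt X t)) : Prop :=
  forall s t : nat,
    sgn t (dif (G s t)) + \sum_(r < s.+1) cmp (G r t) (G s r) = 0.

Definition is_Ainf_alg : Prop :=
  (forall k : nat, (0 < k)%N -> hdeg (m k) (1 - k%:Z)) /\ twisted (gam m).

Definition is_module (E : Ob C) (p : forall k : nat, Mor (bt E k) E) : Prop :=
  (forall k : nat, (0 < k)%N -> hdeg (p k) (1 - k%:Z)) /\ twisted (gam p).

Definition modmor_deg (E F : Ob C) (j : int) (f : forall k : nat, Mor (bt E k) F) : Prop :=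
  forall k : nat, hdeg (f k) (j - k%:Z).

(* B_oo(f): component E(x)A^{(x)s} -> F(x)A^{(x)t} is (-1)^{j t} f_{s-t+1} (x) id^{(x)t} *)
Definition Bmor (E F : Ob C) (j : int) (f : forall k : nat, Mor (bt E k) F) (s t : nat) :
    Mor (bt E s) (bt F t) :=
  if (t <= s)%N then
    sgn (`|j| * t)%N (@tc E F s t _ _ (@liftn E F (s - t)%N 0 t (f (s - t)%N : Mor (bt E (s - t)%N) (bt F 0))))
  else 0.

Definition dTw (E F : Ob C) (gE : forall s t, Mor (bt E s) (bt E t))
    (gF : forall s t, Mor (bt F s) (bt F t)) (n : int)
    (M : forall s t, Mor (bt E s) (bt F t)) (s t : nat) : Mor (bt E s) (bt F t) :=
  sgn t (dif (M s t)) + \sum_(r < s.+1) cmp (gF r t) (M s r)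
  - sgni n (\sum_(r < s.+1) cmp (M r t) (gE s r)).

(* Differential in Nod_oo-A: the unique one with B_oo(d f) = d B_oo(f),
   read off on the components into position 0. *)
Definition dMod (E F : Ob C) (p : forall k, Mor (bt E k) E) (q : forall k, Mor (bt F k) F)
    (n : int) (f : forall k : nat, Mor (bt E k) F) : forall k : nat, Mor (bt E k) F :=
  fun k => dTw (gam p) (gam q) n (Bmor n f) k 0.

(* Composition in Nod_oo-A: the unique one with B_oo(g f) = B_oo(g) B_oo(f). *)
Definition compMod (E F G : Ob C) (jg jf : int) (g : forall k : nat, Mor (bt F k) G)
    (f : forall k : nat, Mor (bt E k) F) : forall k : nat, Mor (bt E k) G :=
  fun k => \sum_(r < k.+1) cmp (Bmor jg g r 0) (Bmor jf f k r).

Definition idMod (E : Ob C) : forall k : nat, Mor (bt E k) E :=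
  fun k => match k return Mor (bt E k) E with 0 => idm E | _ => 0 end.

End Bar.

(* Main.v *)
Require Import Defs.
From HB Require Import structures.
From mathcomp Require Import all_boot all_algebra zify.
From mathcomp Require Import boolp.
Set Implicit Arguments. Unset Strict Implicit. Unset Printing Implicit Defensive.
Import GRing.Theory.
Local Open Scope ring_scope.

(** Homological perturbation.  A right A_oo-module structure on [a] is a
    Maurer-Cartan element [P] of degree 1, without constant term, in the DG
    category whose morphisms [E -> F] are the bar matrices
    (lower triangular matrices determined by their column of maps
    [E (x) A^n -> F]) and whose differential [D] is induced by the one of the
    trivial module.  There [f], [g], [h] remain closed, resp. satisfy
    [gf = 1 + Dh].  As [Ph] is nilpotent in each entry, [X = P + PhX] has a
    unique solution, which satisfies [DX = - X gf X] and [X = P + XhP]; then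
    [q = f X g], [phi = f + f X h], [psi = g + h X g] and [H = h + h X h] work. *)

(** * Signs in an abelian group *)

Section Signs.
Variable V : zmodType.
Implicit Types (x y : V) (n k : nat).

Lemma sgn_eq n k x : odd n = odd k -> sgn n x = sgn k x.
Proof. by rewrite /sgn => ->. Qed.

Lemma sgnS n x : sgn n.+1 x = - sgn n x.
Proof. by rewrite /sgn /=; case: odd => //=; rewrite opprK. Qed.

Lemma sgn_add n k x : sgn n (sgn k x) = sgn (n + k) x.
Proof. by rewrite /sgn oddD; case: odd; case: odd => //=; rewrite opprK. Qed.

Lemma sgn0 n : sgn n (0 : V) = 0.
Proof. by rewrite /sgn oppr0 if_same. Qed.

Lemma sgnN n x : sgn n (- x) = - sgn n x.
Proof. by rewrite /sgn; case: odd. Qed.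

Lemma sgnD n x y : sgn n (x + y) = sgn n x + sgn n y.
Proof. by rewrite /sgn; case: odd => //; rewrite opprD. Qed.

Lemma sgn_sum I (r : seq I) (Q : pred I) (F : I -> V) n :
  sgn n (\sum_(i <- r | Q i) F i) = \sum_(i <- r | Q i) sgn n (F i).
Proof. by apply: (big_morph (sgn n)) => [x y|]; rewrite ?sgnD ?sgn0. Qed.

End Signs.

Lemma odd_abszD (i j : int) : odd (absz (i + j)) = odd (absz i) (+) odd (absz j).
Proof. lia. Qed.

(** * Formal consequences of additivity *)

Section Additive.
Variables (U V : zmodType) (phi : U -> V).
Hypothesis phiD : forall x y, phi (x + y) = phi x + phi y.

Lemma additive0 : phi 0 = 0.
Proof. by apply: (addrI (phi 0)); rewrite -phiD !addr0. Qed.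

Lemma additiveN x : phi (- x) = - phi x.
Proof. by apply: (addrI (phi x)); rewrite -phiD !subrr additive0. Qed.

Lemma additive_sgn n x : phi (sgn n x) = sgn n (phi x).
Proof. by rewrite /sgn; case: odd; rewrite ?additiveN. Qed.

Lemma additive_sum I (r : seq I) (Q : pred I) (F : I -> U) :
  phi (\sum_(i <- r | Q i) F i) = \sum_(i <- r | Q i) phi (F i).
Proof. exact: (big_morph phi phiD additive0). Qed.

End Additive.

(** * Bilinearity, Leibniz and Koszul rules in a monoidal DG category *)

Section DGCategory.
Variables (C : dgdata) (HC : dg_axioms C).
Implicit Types X Y Z : Ob C.

Section Composition.
Variables X Y Z : Ob C.
Implicit Types (f : Mor Y Z) (g : Mor X Y).

Let addl g : forall f f', cmp (f + f') g = cmp f g + cmp f' g.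
Proof. by move=> f f'; exact: compDl. Qed.
Let addr f : forall g g', cmp f (g + g') = cmp f g + cmp f g'.
Proof. by move=> g g'; exact: compDr. Qed.

Lemma cmp0m g : cmp 0 g = 0 :> Mor X Z.
Proof. exact: additive0 (addl g). Qed.
Lemma cmpm0 f : cmp f 0 = 0 :> Mor X Z.
Proof. exact: additive0 (addr f). Qed.
Lemma cmpNm f g : cmp (- f) g = - cmp f g.
Proof. exact: additiveN (addl g) f. Qed.
Lemma cmpmN f g : cmp f (- g) = - cmp f g.
Proof. exact: additiveN (addr f) g. Qed.
Lemma cmp_sgnl n f g : cmp (sgn n f) g = sgn n (cmp f g).
Proof. exact: additive_sgn (addl g) n f. Qed.
Lemma cmp_sgnr n f g : cmp f (sgn n g) = sgn n (cmp f g).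
Proof. exact: additive_sgn (addr f) n g. Qed.
Lemma cmp_suml I (r : seq I) (Q : pred I) (F : I -> Mor Y Z) g :
  cmp (\sum_(i <- r | Q i) F i) g = \sum_(i <- r | Q i) cmp (F i) g.
Proof. exact: additive_sum (addl g) _ r Q F. Qed.
Lemma cmp_sumr I (r : seq I) (Q : pred I) (F : I -> Mor X Y) f :
  cmp f (\sum_(i <- r | Q i) F i) = \sum_(i <- r | Q i) cmp f (F i).
Proof. exact: additive_sum (addr f) _ r Q F. Qed.

End Composition.

Section Differential.
Variables X Y : Ob C.
Implicit Types f : Mor X Y.

Let addd : forall f f', dif (f + f') = dif f + dif f'.
Proof. by move=> f f'; exact: difD. Qed.

Lemma dif0 : dif 0 = 0 :> Mor X Y.
Proof. exact: additive0 addd. Qed.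
Lemma dif_sgn n f : dif (sgn n f) = sgn n (dif f).
Proof. exact: additive_sgn addd n f. Qed.
Lemma dif_sum I (r : seq I) (Q : pred I) (F : I -> Mor X Y) :
  dif (\sum_(i <- r | Q i) F i) = \sum_(i <- r | Q i) dif (F i).
Proof. exact: additive_sum addd _ r Q F. Qed.

Lemma hdeg_sgn n f d : hdeg f d -> hdeg (sgn n f) d.
Proof. by move=> Hf; rewrite /sgn; case: odd => //; exact: (hdegN HC). Qed.

Lemma hdeg_sum I (r : seq I) (Q : pred I) (F : I -> Mor X Y) d :
  (forall i, Q i -> hdeg (F i) d) -> hdeg (\sum_(i <- r | Q i) F i) d.
Proof.
move=> HF; apply: (big_ind (fun f => hdeg f d)) => //; first exact: (hdeg0 HC).
by move=> *; exact: (hdegD HC).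
Qed.

End Differential.

Lemma dif_cmp_closedl X Y Z (f : Mor Y Z) (g : Mor X Y) :
  hdeg f 0 -> dif f = 0 -> dif (cmp f g) = cmp f (dif g).
Proof. by move=> f0 df; rewrite (dif_comp HC _ f0) df cmp0m add0r. Qed.

Lemma dif_cmp_closedr X Y Z (f : Mor Y Z) (g : Mor X Y) n :
  hdeg f n -> dif g = 0 -> dif (cmp f g) = cmp (dif f) g.
Proof. by move=> Hf dg; rewrite (dif_comp HC _ Hf) dg cmpm0 /sgni sgn0 addr0. Qed.

(** The Leibniz rule for the composite of the identity with itself reads d(id) = d(id) + d(id). *)
Lemma dif_idm X : dif (idm X) = 0.
Proof.
have /eqP := dif_comp HC (idm X) (hdeg_id HC X).
by rewrite !(comp1m HC) !(compm1 HC) /sgni -subr_eq0 opprD addNKr oppr_eq0 => /eqP.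
Qed.

Section Tensor.
Variables X X' Y Y' : Ob C.
Implicit Types (f : Mor X X') (g : Mor Y Y').

Let addl g : forall f f', tensm (f + f') g = tensm f g + tensm f' g.
Proof. by move=> f f'; exact: tensmDl. Qed.
Let addr f : forall g g', tensm f (g + g') = tensm f g + tensm f g'.
Proof. by move=> g g'; exact: tensmDr. Qed.

Lemma tensm0m g : tensm 0 g = 0 :> Mor (tens X Y) (tens X' Y').
Proof. exact: additive0 (addl g). Qed.
Lemma tensmm0 f : tensm f 0 = 0 :> Mor (tens X Y) (tens X' Y').
Proof. exact: additive0 (addr f). Qed.
Lemma tensmmN f g : tensm f (- g) = - tensm f g.
Proof. exact: additiveN (addr f) g. Qed.
Lemma tensm_sgnl n f g : tensm (sgn n f) g = sgn n (tensm f g).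
Proof. exact: additive_sgn (addl g) n f. Qed.
Lemma tensm_sgnr n f g : tensm f (sgn n g) = sgn n (tensm f g).
Proof. exact: additive_sgn (addr f) n g. Qed.
Lemma tensm_suml I (r : seq I) (Q : pred I) (F : I -> Mor X X') g :
  tensm (\sum_(i <- r | Q i) F i) g = \sum_(i <- r | Q i) tensm (F i) g.
Proof. exact: additive_sum (addl g) _ r Q F. Qed.
Lemma tensm_sumr I (r : seq I) (Q : pred I) (F : I -> Mor Y Y') f :
  tensm f (\sum_(i <- r | Q i) F i) = \sum_(i <- r | Q i) tensm f (F i).
Proof. exact: additive_sum (addr f) _ r Q F. Qed.

End Tensor.

Lemma tensm_cmp1 X X' X'' Y (f : Mor X' X'') (g : Mor X X') n :
  hdeg g n -> cmp (tensm f (idm Y)) (tensm g (idm Y)) = tensm (cmp f g) (idm Y).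
Proof. by move=> Hg; rewrite (tensm_comp HC _ _ (hdeg_id HC Y) Hg) mul0r (comp1m HC). Qed.

Lemma tensm_1cmp X Y Y' Y'' (f : Mor Y' Y'') (g : Mor Y Y') n :
  hdeg f n -> cmp (tensm (idm X) f) (tensm (idm X) g) = tensm (idm X) (cmp f g).
Proof. by move=> Hf; rewrite (tensm_comp HC _ _ Hf (hdeg_id HC X)) mulr0 (comp1m HC). Qed.

Lemma cmp_tensm_m1_1m X X' Y Y' (f : Mor X X') (g : Mor Y Y') :
  cmp (tensm f (idm Y')) (tensm (idm X) g) = tensm f g.
Proof.
by rewrite (tensm_comp HC _ _ (hdeg_id HC _) (hdeg_id HC _)) mul0r (comp1m HC) (compm1 HC).
Qed.

(** In this order [g] is moved past [f], which costs a Koszul sign; the opposite order is free of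
    signs. *)
Lemma cmp_tensm_1m_m1 X X' Y Y' (f : Mor X X') (g : Mor Y Y') n k :
  hdeg g n -> hdeg f k ->
  cmp (tensm (idm X') g) (tensm f (idm Y)) = sgni (n * k) (tensm f g).
Proof. by move=> Hg Hf; rewrite (tensm_comp HC _ _ Hg Hf) (comp1m HC) (compm1 HC). Qed.

Lemma dif_tensm_m1 X X' Y (f : Mor X X') n :
  hdeg f n -> dif (tensm f (idm Y)) = tensm (dif f) (idm Y).
Proof. by move=> Hf; rewrite (dif_tensm HC _ Hf) dif_idm tensmm0 /sgni sgn0 addr0. Qed.

Lemma dif_tensm_1m X Y Y' (g : Mor Y Y') :
  dif (tensm (idm X) g) = tensm (idm X) (dif g).
Proof. by rewrite (dif_tensm HC _ (hdeg_id HC X)) dif_idm tensm0m add0r. Qed.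

Lemma hdeg_tensm1 X X' Y (f : Mor X X') n : hdeg f n -> hdeg (tensm f (idm Y)) n.
Proof. by move=> Hf; rewrite -[n]addr0; apply: (hdeg_tensm HC Hf (hdeg_id HC Y)). Qed.

Lemma hdeg_1tensm X Y Y' (g : Mor Y Y') n : hdeg g n -> hdeg (tensm (idm X) g) n.
Proof. by move=> Hg; rewrite -[n]add0r; apply: (hdeg_tensm HC (hdeg_id HC X) Hg). Qed.

Lemma hdeg_cmp0m X Y Z (f : Mor Y Z) (g : Mor X Y) n :
  hdeg f 0 -> hdeg g n -> hdeg (cmp f g) n.
Proof. by move=> Hf Hg; rewrite -[n]add0r; apply: (hdeg_comp HC Hf Hg). Qed.

Lemma hdeg_cmpm0 X Y Z (f : Mor Y Z) (g : Mor X Y) n :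
  hdeg f n -> hdeg g 0 -> hdeg (cmp f g) n.
Proof. by move=> Hf Hg; rewrite -[n]addr0; apply: (hdeg_comp HC Hf Hg). Qed.

End DGCategory.

(** * Words [bt A X n] and their reassociations *)

Section Words.
Variables (C : dgdata) (HC : dg_axioms C) (A : Ob C).
Implicit Types X Y : Ob C.

(** Equality proofs between natural numbers are unique, so the cast in [tc] runs along [erefl]. *)
Lemma tc_id X Y s t (f : Mor (bt A X s) (bt A Y t)) : tc s t f = f.
Proof.
rewrite /tc; case: eqnP => // e1; case: eqnP => // e2.
by rewrite (eq_irrelevance e1 erefl) (eq_irrelevance e2 erefl).
Qed.

Lemma tc_neq X Y s t s' t' (f : Mor (bt A X s') (bt A Y t')) :
  s' <> s \/ t' <> t -> tc s t f = 0.
Proof. by rewrite /tc; case: eqnP => // e1; case: eqnP => // e2 []. Qed.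

Lemma tc_tensm X Y s t s' t' (f : Mor (bt A X s') (bt A Y t')) :
  @tc C A X Y s.+1 t.+1 s'.+1 t'.+1 (tensm f (idm A)) = tensm (tc s t f) (idm A).
Proof.
have [e1|n1] := eqVneq s' s; last first.
  by rewrite !tc_neq ?(tensm0m HC) //; left; [|case]; apply/eqP.
have [e2|n2] := eqVneq t' t; last first.
  by rewrite !tc_neq ?(tensm0m HC) //; right; [|case]; apply/eqP.
by case: _ / e1; case: _ / e2; rewrite !tc_id.
Qed.

(** The matrix of [f] tensored with identities of [A]. Recursion on both indices keeps the source
    and target lengths independent, so that no cast appears. *)
Fixpoint diag X Y (f : Mor X Y) (s t : nat) : Mor (bt A X s) (bt A Y t) :=
  match s, t return Mor (bt A X s) (bt A Y t) with
  | 0, 0 => f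
  | s'.+1, t'.+1 => tensm (diag f s' t') (idm A)
  | _, _ => 0
  end.

Lemma diag_neq X Y (f : Mor X Y) s t : s != t -> diag f s t = 0.
Proof.
elim: s t => [|s IH] [|t] //= st.
by rewrite IH ?(tensm0m HC).
Qed.

Lemma diag_id X s : diag (idm X) s s = idm (bt A X s).
Proof. by elim: s => //= s ->; rewrite (tensm11 HC). Qed.

Lemma hdeg_diag X Y (f : Mor X Y) n s t : hdeg f n -> hdeg (diag f s t) n.
Proof.
move=> Hf; elim: s t => [|s IH] [|t] //=; try exact: (hdeg0 HC).
exact: (hdeg_tensm1 HC).
Qed.

(* The matrix form (zero unless [s = t + n]) of the reassociation [splitA]. *)
Fixpoint spl X (s t n : nat) {struct n} : Mor (bt A X s.+1) (tens (bt A X t) (bt A A n)) :=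
  match n return Mor (bt A X s.+1) (tens (bt A X t) (bt A A n)) with
  | 0 => diag (idm X) s.+1 t.+1
  | n'.+1 =>
    match s return Mor (bt A X s.+1) (tens (bt A X t) (bt A A n'.+1)) with
    | 0 => 0
    | s'.+1 => cmp (assoc (bt A X t) (bt A A n') A) (tensm (spl X s' t n') (idm A))
    end
  end.

Lemma spl_splitA X t n : spl X (n + t) t n = splitA A X t n.
Proof. by elim: n => [|n /= ->] //; exact: (diag_id X t.+1). Qed.

Lemma hdeg_spl X s t n : hdeg (spl X s t n) 0.
Proof.
elim: n s => [|n IH] s; first exact: (hdeg_diag s.+1 t.+1 (hdeg_id HC X)).
case: s => [|s] /=; first exact: (hdeg0 HC).
exact: (hdeg_cmp0m HC (hdeg_assoc HC _ _ _).1 (hdeg_tensm1 HC _ (IH s))).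
Qed.

(** The regrouping isomorphism that isolates [X] in front of the letters [A]; through it, operations
    on words in [A] alone act behind [X]. *)
Fixpoint sig X s : Mor (bt A X s.+1) (tens X (bt A A s)) :=
  match s return Mor (bt A X s.+1) (tens X (bt A A s)) with
  | 0 => idm _
  | s'.+1 => cmp (assoc X (bt A A s') A) (tensm (sig X s') (idm A))
  end.

Fixpoint sigV X s : Mor (tens X (bt A A s)) (bt A X s.+1) :=
  match s return Mor (tens X (bt A A s)) (bt A X s.+1) with
  | 0 => idm _
  | s'.+1 => cmp (tensm (sigV X s') (idm A)) (assocV X (bt A A s') A)
  end.

Lemma hdeg_sig X s : hdeg (sig X s) 0.
Proof.
elim: s => [|s IH] /=; first exact: (hdeg_id HC).
exact: (hdeg_cmp0m HC (hdeg_assoc HC _ _ _).1 (hdeg_tensm1 HC _ IH)).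
Qed.

Lemma hdeg_sigV X s : hdeg (sigV X s) 0.
Proof.
elim: s => [|s IH] /=; first exact: (hdeg_id HC).
exact: (hdeg_cmp0m HC (hdeg_tensm1 HC _ IH) (hdeg_assoc HC _ _ _).2).
Qed.

Lemma sigK X s : cmp (sigV X s) (sig X s) = idm _.
Proof.
elim: s => [|s IH] /=; first exact: (comp1m HC).
rewrite -(Defs.compA HC) (Defs.compA HC (assocV _ _ _)) (assocK HC X (bt A A s) A).1 (comp1m HC).
by rewrite (tensm_cmp1 HC _ _ (hdeg_sig X s)) IH (tensm11 HC).
Qed.

Lemma sigVK X s : cmp (sig X s) (sigV X s) = idm _.
Proof.
elim: s => [|s IH] /=; first exact: (comp1m HC).
rewrite -(Defs.compA HC) (Defs.compA HC (tensm _ _) (tensm _ _)).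
rewrite (tensm_cmp1 HC _ _ (hdeg_sigV X s)) IH (tensm11 HC) (comp1m HC).
exact: (assocK HC X (bt A A s) A).2.
Qed.

Lemma dif_sig X s : dif (sig X s) = 0.
Proof.
elim: s => [|s IH] /=; first exact: (dif_idm HC).
case: (hdeg_assoc HC X (bt A A s) A) => a0 _; case: (dif_assoc HC X (bt A A s) A) => da _.
by rewrite (dif_cmp_closedl HC) // (dif_tensm_m1 HC _ (hdeg_sig X s)) IH (tensm0m HC) (cmpm0 HC).
Qed.

Lemma dif_sigV X s : dif (sigV X s) = 0.
Proof.
elim: s => [|s IH] /=; first exact: (dif_idm HC).
case: (dif_assoc HC X (bt A A s) A) => _ da.
rewrite (dif_cmp_closedr HC (hdeg_tensm1 HC _ (hdeg_sigV X s)) da)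
   (dif_tensm_m1 HC _ (hdeg_sigV X s)) IH (tensm0m HC).
exact: (cmp0m HC).
Qed.

(** Naturality of [sig] in [X], inherited from the associator; off the diagonal both sides
    vanish. *)
Lemma sig_diag X Y (f : Mor X Y) n s t : hdeg f n ->
  cmp (sig Y t) (diag f s.+1 t.+1) = cmp (tensm f (diag (idm A) s t)) (sig X s).
Proof.
move=> Hf; elim: s t => [|s IH] [|t].
- by rewrite /= (comp1m HC) (compm1 HC).
- by rewrite !diag_neq // (tensmm0 HC) (cmpm0 HC) (cmp0m HC).
- by rewrite !diag_neq // (tensmm0 HC) (cmpm0 HC) (cmp0m HC).
have H1 : hdeg (diag f s.+1 t.+1) n := hdeg_diag s.+1 t.+1 Hf.
rewrite [LHS]/= -(Defs.compA HC).
rewrite (tensm_cmp1 HC A (sig Y t) H1) (IH t).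
rewrite -(tensm_cmp1 HC _ _ (hdeg_sig X s)) (Defs.compA HC) (assoc_nat HC).
by rewrite -(Defs.compA HC).
Qed.

Lemma spl0 X t n : spl X 0 t.+1 n = 0.
Proof. by case: n => //=; rewrite (tensm0m HC). Qed.

(** Coherence: two ways of cutting a word into [X], a middle block and a final block agree. Each
    step of the induction on the final block uses the pentagon and the naturality of the
    associator. *)
Lemma assoc_sig_spl X s t n :
  cmp (assoc X (bt A A t) (bt A A n))
      (cmp (tensm (sig X t) (idm (bt A A n))) (spl X s.+1 t.+1 n)) =
  cmp (tensm (idm X) (spl A s t n)) (sig X s.+1).
Proof.
elim: n s => [|n IH] s.
  rewrite (Defs.compA HC).
  exact: (sig_diag s.+1 t.+1 (hdeg_id HC X)).
case: s => [|s].
  by rewrite /= spl0 (tensm0m HC) !(cmpm0 HC) (tensmm0 HC) (cmp0m HC).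
(* The last letter is split off the identity so that naturality of the associator applies. *)
have -> : idm (bt A A n.+1) = tensm (idm (bt A A n)) (idm A) by rewrite (tensm11 HC).
rewrite [spl X _ _ _]/= [spl A _ _ _]/=.
rewrite [in LHS](Defs.compA HC (tensm _ _)).
rewrite -(assoc_nat HC (sig X t) (idm (bt A A n)) (idm A)) -(Defs.compA HC (assoc _ _ _)).
rewrite (tensm_cmp1 HC A (tensm (sig X t) (idm (bt A A n))) (hdeg_spl X s.+1 t.+1 n)).
rewrite (Defs.compA HC (assoc X _ _)) (pentagon HC) -!(Defs.compA HC).
have H : hdeg (cmp (tensm (sig X t) (idm (bt A A n))) (spl X s.+1 t.+1 n)) 0.
  apply: (hdeg_cmp0m HC); last exact: hdeg_spl.
  exact/(hdeg_tensm1 HC)/hdeg_sig.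
rewrite (tensm_cmp1 HC A _ H) IH.
rewrite -(tensm_cmp1 HC A _ (hdeg_sig _ _)).
rewrite (Defs.compA HC (assoc _ _ _)) (assoc_nat HC) !(Defs.compA HC).
rewrite (tensm_1cmp HC _ _ (hdeg_assoc HC _ _ _).1).
by rewrite -!(Defs.compA HC).
Qed.

End Words.

(** * Recursive, cast-free description of the bar components *)

Section BarComponents.
Variables (C : dgdata) (HC : dg_axioms C) (A : Ob C).
Implicit Types X Y : Ob C.

Section Bmor.
Variables (X Y : Ob C) (j : int).
Implicit Types f : forall k, Mor (bt A X k) Y.

Lemma tc_col0 f n s : n = s -> tc s 0 (f n : Mor (bt A X n) (bt A Y 0)) = f s.
Proof. by move=> <-; rewrite tc_id. Qed.

Lemma Bmor_s0 f s : Bmor j f s 0 = f s.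
Proof. by rewrite /Bmor /= muln0; apply: tc_col0; rewrite subn0. Qed.

Lemma Bmor_SS f s t : Bmor j f s.+1 t.+1 = sgni j (tensm (Bmor j f s t) (idm A)).
Proof.
rewrite /Bmor ltnS subSS; case: leqP => _; last by rewrite (tensm0m HC) /sgni sgn0.
by rewrite mulnS -sgn_add (tensm_sgnl HC); congr (sgn _ (sgn _ _)); exact: (tc_tensm HC).
Qed.

Lemma Bmor_upper f s t : (s < t)%N -> Bmor j f s t = 0.
Proof. by move=> st; rewrite /Bmor leqNgt st. Qed.

End Bmor.

Variable m : forall k, Mor (bt A A k) A.

(** Up to sign the summand j = 0 of [gam] from [s.+1] to [t.+1]: the operation [m] consumes the last
    letters of the word. *)
Definition insm X (s t : nat) : Mor (bt A X s.+1) (bt A X t.+1) :=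
  if (t < s)%N then cmp (tensm (idm (bt A X t)) (m (s - t)%N)) (spl A X s t (s - t)%N) else 0.

Lemma tc_insx X a c s t (u : Mor (bt A A c) A) : a = t -> (c + t)%N = s ->
  tc s.+1 t.+1 (insx X a u) = cmp (tensm (idm (bt A X t)) u) (spl A X s t c).
Proof. by move=> -> <-; rewrite tc_id /insx (spl_splitA HC). Qed.

Lemma gam_s0 X (p : forall k, Mor (bt A X k) X) s :
  gam m p s 0 = if (0 < s)%N then p s else 0.
Proof.
rewrite /gam; case: ltnP => // _.
by rewrite big_ord0 add0r /= mul0n; apply: tc_col0; rewrite subn0.
Qed.

Lemma gam_upper X (p : forall k, Mor (bt A X k) X) s t : (s <= t)%N -> gam m p s t = 0.
Proof. by move=> st; rewrite /gam ltnNge st. Qed.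

(** Only the summand j = 0 touches the last letter. All other summands, and the term in [p], end in
    the identity of [A] and are those of [gam m p s t] tensored with it; the change of exponents
    amounts to a sign -1. *)
Lemma gam_SS X (p : forall k, Mor (bt A X k) X) s t :
  gam m p s.+1 t.+1 =
  - tensm (gam m p s t) (idm A) + sgn (t.+1 * (s - t).+1)%N (insm X s t).
Proof.
rewrite /gam /insm ltnS; case: leqP => ts.
  by rewrite (tensm0m HC) oppr0 sgn0 addr0.
rewrite subSS big_ord_recl mul0n.
have -> : tc s.+1 t.+1 (liftn 0 (insx X (t.+1.-1 - @ord0 t)%N (m (s - t)%N))) =
  cmp (tensm (idm (bt A X t)) (m (s - t)%N)) (spl A X s t (s - t)%N).
  by rewrite [LHS]tc_insx // ?subn0 // subnK // ltnW.
rewrite -addrA sgnD [RHS]addrC; congr (_ + _).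
rewrite (tensm_sgnl HC) (tensmDl HC) (tensm_suml HC) -sgnS !sgnD !sgn_sum.
congr (_ + _).
  case: t ts => [|t] ts; first by rewrite !big_ord0.
  apply: eq_bigr => i _.
  rewrite (tensm_sgnl HC) !sgn_add -(tc_tensm HC).
  apply: sgn_eq; rewrite lift0.
  by rewrite !(oddD, oddM, oddS); case: odd; case: odd; case: odd.
rewrite (tensm_sgnl HC) !sgn_add -(tc_tensm HC).
apply: sgn_eq.
by rewrite !(oddD, oddM, oddS); case: odd; case: odd.
Qed.

End BarComponents.

(** * Matrices between words and their additive group *)

Definition mat (C : dgdata) (A X Y : Ob C) := forall s t, Mor (bt A X s) (bt A Y t).

Section MatrixGroup.
Variables (C : dgdata) (A X Y : Ob C).
Implicit Types M N : mat A X Y.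

Lemma matP M N : (forall s t, M s t = N s t) -> M = N.
Proof.
by move=> E; apply: functional_extensionality_dep => s; apply: functional_extensionality_dep => t.
Qed.

Definition mat_zero : mat A X Y := fun s t => 0.
Definition mat_opp M : mat A X Y := fun s t => - M s t.
Definition mat_add M N : mat A X Y := fun s t => M s t + N s t.

Lemma mat_addA : associative mat_add.
Proof. by move=> M N L; apply: matP => s t; exact: addrA. Qed.
Lemma mat_addC : commutative mat_add.
Proof. by move=> M N; apply: matP => s t; exact: addrC. Qed.
Lemma mat_add0 : left_id mat_zero mat_add.
Proof. by move=> M; apply: matP => s t; exact: add0r. Qed.
Lemma mat_addN : left_inverse mat_zero mat_opp mat_add.
Proof. by move=> M; apply: matP => s t; exact: addNr. Qed.

(** Equality and choice come from classical axioms. The resulting [zmodType] lets whole matrices be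
    manipulated as in ring theory. *)
HB.instance Definition _ := gen_eqMixin (mat A X Y).
HB.instance Definition _ := gen_choiceMixin (mat A X Y).
HB.instance Definition _ :=
  GRing.isZmodule.Build (mat A X Y) mat_addA mat_addC mat_add0 mat_addN.

Lemma mat_sgnE n M s t : sgn n M s t = sgn n (M s t).
Proof. by rewrite /sgn; case: odd. Qed.

Lemma mat_addE M N s t : (M + N) s t = M s t + N s t.
Proof. by []. Qed.

Lemma mat_oppE M s t : (- M) s t = - M s t.
Proof. by []. Qed.

End MatrixGroup.

(** * Product and differential of matrices *)

Section MatrixProduct.
Variables (C : dgdata) (HC : dg_axioms C) (A : Ob C).
Implicit Types X Y Z W : Ob C.

(* Summing over [t <= r <= s] only, as in an incidence algebra, makes the
   product associative without any triangularity assumption. *)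
Definition mmul X Y Z (M : mat A Y Z) (N : mat A X Y) : mat A X Z :=
  fun s t => \sum_(r < s.+1 | (t <= r)%N) cmp (M r t) (N s r).

Definition mdif X Y (M : mat A X Y) : mat A X Y := fun s t => sgn t (dif (M s t)).

Definition mone X : mat A X X := diag A (idm X).

Definition tri X Y (M : mat A X Y) := forall s t, (s < t)%N -> M s t = 0.

Lemma mmulDl X Y Z (M M' : mat A Y Z) (N : mat A X Y) :
  mmul (M + M') N = mmul M N + mmul M' N.
Proof.
by apply: matP => s t; rewrite mat_addE /mmul -big_split; apply: eq_bigr => r _; exact: (compDl HC).
Qed.

Lemma mmulDr X Y Z (M : mat A Y Z) (N N' : mat A X Y) :
  mmul M (N + N') = mmul M N + mmul M N'.
Proof.
by apply: matP => s t; rewrite mat_addE /mmul -big_split; apply: eq_bigr => r _; exact: (compDr HC).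
Qed.

Lemma mmul0m X Y Z (N : mat A X Y) : mmul 0 N = 0 :> mat A X Z.
Proof. exact: (additive0 (fun M M' : mat A Y Z => mmulDl M M' N)). Qed.
Lemma mmulm0 X Y Z (M : mat A Y Z) : mmul M 0 = 0 :> mat A X Z.
Proof. exact: (additive0 (mmulDr (X:=X) M)). Qed.
Lemma mmulNm X Y Z (M : mat A Y Z) (N : mat A X Y) : mmul (- M) N = - mmul M N.
Proof. exact: (additiveN (fun M M' : mat A Y Z => mmulDl M M' N)). Qed.
Lemma mmulmN X Y Z (M : mat A Y Z) (N : mat A X Y) : mmul M (- N) = - mmul M N.
Proof. exact: (additiveN (mmulDr M)). Qed.

(** Both sides sum over the chains [t <= r <= u <= s]. *)
Lemma mmulA W X Y Z (M : mat A Y Z) (N : mat A X Y) (L : mat A W X) :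
  mmul M (mmul N L) = mmul (mmul M N) L.
Proof.
apply: matP => s t; rewrite /mmul.
transitivity (\sum_(r < s.+1 | (t <= r)%N) \sum_(u < s.+1 | (r <= u)%N)
    cmp (M r t) (cmp (N u r) (L s u))).
  by apply: eq_bigr => r _; rewrite (cmp_sumr HC).
rewrite (exchange_big_dep (fun u : 'I_s.+1 => t <= u)%N) /=; last first.
  by move=> r u tr ru; exact: leq_trans ru.
apply: eq_bigr => u tu; rewrite (cmp_suml HC).
rewrite (big_ord_widen_cond s.+1 (fun r => t <= r)%N
  (fun r => cmp (cmp (M r t) (N u r)) (L s u))) //.
by apply: eq_big => [r|r _]; rewrite ?ltnS // (Defs.compA HC).
Qed.

(** For a triangular left factor the product agrees with the unrestricted sums in [twisted], [dTw]
    and [compMod]. *)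
Lemma mmulE X Y Z (M : mat A Y Z) (N : mat A X Y) s t : tri M ->
  mmul M N s t = \sum_(r < s.+1) cmp (M r t) (N s r).
Proof.
move=> TM; rewrite /mmul big_mkcond; apply: eq_bigr => r _.
by case: leqP => // rt; rewrite TM // (cmp0m HC).
Qed.

Lemma mmul_diagr X Y Z (M : mat A Y Z) (N : mat A X Y) s t :
  (forall s t, s != t -> N s t = 0) ->
  mmul M N s t = if (t <= s)%N then cmp (M s t) (N s s) else 0.
Proof.
move=> DN; rewrite /mmul big_mkcond big_ord_recr /= big1 ?add0r // => r _.
by rewrite DN ?(cmpm0 HC) ?if_same // gtn_eqF.
Qed.

Lemma mmul_diagl X Y Z (M : mat A Y Z) (N : mat A X Y) s t :
  (forall s t, s != t -> M s t = 0) ->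
  mmul M N s t = if (t <= s)%N then cmp (M t t) (N s t) else 0.
Proof.
move=> DM; rewrite /mmul; case: leqP => st; last first.
  rewrite big1 // => r tr; have := ltn_ord r.
  by rewrite ltnS leqNgt (leq_trans st tr).
rewrite -ltnS in st; rewrite (bigD1 (Ordinal st)) //= big1 ?addr0 // => r /andP[_ rt].
by rewrite DM // (cmp0m HC).
Qed.

Lemma tri_mmul X Y Z (M : mat A Y Z) (N : mat A X Y) : tri (mmul M N).
Proof.
move=> s t st; rewrite /mmul big1 // => r tr.
by have := ltn_ord r; rewrite ltnS leqNgt (leq_trans st tr).
Qed.

Lemma mmul1m X Y (M : mat A X Y) : tri M -> mmul (mone Y) M = M.
Proof.
move=> TM; apply: matP => s t; rewrite mmul_diagl; last by move=> *; exact: (diag_neq HC).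
by rewrite /mone (diag_id HC) (comp1m HC); case: leqP => // st; rewrite TM.
Qed.

Lemma mmulm1 X Y (M : mat A X Y) : tri M -> mmul M (mone X) = M.
Proof.
move=> TM; apply: matP => s t; rewrite mmul_diagr; last by move=> *; exact: (diag_neq HC).
by rewrite /mone (diag_id HC) (compm1 HC); case: leqP => // st; rewrite TM.
Qed.

(** Total degree [n]: a word of length [s] sits in position [-s], so the entry from [s] to [t] has
    degree [n - s + t]. *)
Definition homog X Y n (M : mat A X Y) :=
  forall s t, hdeg (M s t) (n + t%:Z - s%:Z).

(** The sign of exponent [t] in [mdif] combines with the degree [n + t - r] of [M r t] to exponent
    [n + r], which is [n] plus the exponent in [mdif N]. *)
Lemma mdif_mmul X Y Z n (M : mat A Y Z) (N : mat A X Y) : homog n M ->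
  mdif (mmul M N) = mmul (mdif M) N + sgni n (mmul M (mdif N)).
Proof.
move=> HM; apply: matP => s t.
rewrite mat_addE /sgni mat_sgnE /mdif /mmul (dif_sum HC) !sgn_sum -big_split.
apply: eq_bigr => r _ /=; rewrite (dif_comp HC _ (HM r t)) sgnD (cmp_sgnl HC) (cmp_sgnr HC).
congr (_ + _); rewrite !sgn_add; apply: sgn_eq.
by rewrite !oddD !odd_abszD abszN /=; case: odd; case: odd; case: odd.
Qed.

Lemma homog_mmul X Y Z i j (M : mat A Y Z) (N : mat A X Y) :
  homog i M -> homog j N -> homog (i + j) (mmul M N).
Proof.
move=> HM HN s t; apply: (hdeg_sum HC) => r _.
have -> : i + j + t%:Z - s%:Z = (i + t%:Z - r%:Z) + (j + r%:Z - s%:Z) by lia.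
exact: (hdeg_comp HC).
Qed.

End MatrixProduct.

(** * Bar matrices: the image of the bar construction *)

Section BarMatrices.
Variables (C : dgdata) (HC : dg_axioms C) (A : Ob C).
Implicit Types X Y Z : Ob C.

(** An intrinsic characterization of the matrices [Bmor j f] with [f] of degree [j], stable under
    the matrix operations; [bar_Bmor] and [bar_eq_Bmor] give the two directions. *)
Record bar X Y j (M : mat A X Y) : Prop := Bar {
  bar_homog : homog j M;
  bar_0S : forall t, M 0 t.+1 = 0;
  bar_SS : forall s t, M s.+1 t.+1 = sgni j (tensm (M s t) (idm A))
}.

Lemma bar_tri X Y j (M : mat A X Y) : bar j M -> tri M.
Proof.
move=> BM; elim=> [|s IH] [|t] // st; first exact: (bar_0S BM).
by rewrite (bar_SS BM) IH // (tensm0m HC) /sgni sgn0.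
Qed.

(** The recursion rebuilds a bar matrix from its entries into position 0, so identities between bar
    matrices need checking only there. *)
Lemma bar_ext X Y j (M N : mat A X Y) :
  bar j M -> bar j N -> (forall s, M s 0%N = N s 0%N) -> M = N.
Proof.
move=> BM BN E; apply: matP; elim=> [|s IH] [|t] //.
  by rewrite (bar_0S BM) (bar_0S BN).
by rewrite (bar_SS BM) (bar_SS BN) IH.
Qed.

Lemma bar0 X Y j : bar j (0 : mat A X Y).
Proof.
by split=> [s t|//|s t]; [exact: (hdeg0 HC)|rewrite (tensm0m HC) /sgni sgn0].
Qed.

Lemma barD X Y j (M N : mat A X Y) : bar j M -> bar j N -> bar j (M + N).
Proof.
move=> BM BN; split=> [s t|t|s t].
- exact: (hdegD HC (bar_homog BM s t) (bar_homog BN s t)).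
- by rewrite mat_addE (bar_0S BM) (bar_0S BN) addr0.
rewrite !mat_addE (bar_SS BM) (bar_SS BN).
by rewrite (tensmDl HC) /sgni sgnD.
Qed.

(** Passing from [(s, t)] to [(s.+1, t.+1)] shifts the summation index by one, the index 0 being
    excluded by [t < r]; the signs of the factors add up to exponent [i + j]. *)
Lemma bar_mmul X Y Z i j k (M : mat A Y Z) (N : mat A X Y) :
  k = i + j -> bar i M -> bar j N -> bar k (mmul M N).
Proof.
move=> -> BM BN; split.
- exact: (homog_mmul HC (bar_homog BM) (bar_homog BN)).
- by move=> t; rewrite /mmul big_mkcond big_ord1.
move=> s t; rewrite /mmul big_mkcond big_ord_recl /= add0r -big_mkcond /=.
rewrite (tensm_suml HC) /sgni sgn_sum; apply: eq_big => // r _.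
rewrite (bar_SS BM) (bar_SS BN) (cmp_sgnl HC) (cmp_sgnr HC).
rewrite (tensm_cmp1 HC _ _ (bar_homog BN _ _)) sgn_add.
by apply: sgn_eq; rewrite odd_abszD oddD.
Qed.

Lemma bar_mdif X Y i j (M : mat A X Y) : j = i + 1 -> bar i M -> bar j (mdif M).
Proof.
move=> -> BM; split=> [s t|t|s t]; rewrite /mdif.
- apply/(hdeg_sgn HC); have -> : i + 1 + t%:Z - s%:Z = (i + t%:Z - s%:Z) + 1 by lia.
  exact/(hdeg_dif HC)/(bar_homog BM).
- by rewrite (bar_0S BM) (dif0 HC) sgn0.
rewrite (bar_SS BM) (dif_sgn HC) (dif_tensm_m1 HC _ (bar_homog BM s t)).
rewrite (tensm_sgnl HC) /sgni !sgn_add; apply: sgn_eq.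
by rewrite !oddD odd_abszD /=; case: odd; case: odd.
Qed.

Lemma bar_Bmor X Y j (f : forall k, Mor (bt A X k) Y) :
  modmor_deg j f -> bar j (Bmor j f).
Proof.
move=> Hf; split=> // [|s t]; last exact: (Bmor_SS HC).
have H0 s : hdeg (Bmor j f s 0) (j + 0%:Z - s%:Z).
  by rewrite Bmor_s0; have -> : j + 0%:Z - s%:Z = j - s%:Z by lia.
elim=> [|s IH] [|t]; rewrite ?H0 //; first exact: (hdeg0 HC).
rewrite (Bmor_SS HC); apply/(hdeg_sgn HC)/(hdeg_tensm1 HC).
by have -> : j + t.+1%:Z - s.+1%:Z = j + t%:Z - s%:Z by lia.
Qed.

Lemma bar_eq_Bmor X Y j (M : mat A X Y) : bar j M -> M = Bmor j (fun k => M k 0%N).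
Proof.
move=> BM; apply: (bar_ext BM); last by move=> s; rewrite Bmor_s0.
by apply: bar_Bmor => k; have := bar_homog BM k 0; rewrite addr0.
Qed.

Lemma bar_mone X : bar 0 (mone A X).
Proof.
split=> // s t; have [<-|st] := eqVneq s t.
  by rewrite addrK; exact: (hdeg_diag HC _ _ _ (hdeg_id HC X)).
by rewrite /mone (diag_neq HC) //; exact: (hdeg0 HC).
Qed.

Definition strict X Y (f : Mor X Y) : forall k, Mor (bt A X k) Y :=
  fun k => match k return Mor (bt A X k) Y with 0 => f | _ => 0 end.

Lemma bar_strict X Y j (f : Mor X Y) : hdeg f j -> bar j (Bmor j (strict f)).
Proof.
by move=> Hf; apply: bar_Bmor => -[|k]; rewrite ?subr0 //; exact: (hdeg0 HC).
Qed.

Lemma Bmor_strict X Y j (f : Mor X Y) s t :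
  Bmor j (strict f) s t = sgn (absz j * t)%N (diag A f s t).
Proof.
elim: s t => [|s IH] [|t]; rewrite ?Bmor_s0 ?muln0 ?(Bmor_SS HC) //.
  by rewrite sgn0.
by rewrite IH (tensm_sgnl HC) /sgni sgn_add mulnS.
Qed.

End BarMatrices.

(** * Splitting the bar differential into a trivial part and a Maurer-Cartan element *)

Section BarDifferential.
Variables (C : dgdata) (HC : dg_axioms C) (A : Ob C).
Variable m : forall k, Mor (bt A A k) A.
Hypothesis Hm : is_Ainf_alg m.
Implicit Types X Y : Ob C.

Lemma hdeg_insm X s t : hdeg (insm m X s t) (1 + t%:Z - s%:Z).
Proof.
rewrite /insm; case: ltnP => ts; last exact: (hdeg0 HC).
apply/(hdeg_cmpm0 HC); last exact: (hdeg_spl HC).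
have -> : 1 + t%:Z - s%:Z = 1 - (s - t)%N%:Z by lia.
by apply/(hdeg_1tensm HC)/Hm.1; rewrite subn_gt0.
Qed.

Lemma homog_gam X (p : forall k, Mor (bt A X k) X) :
  (forall k, (0 < k)%N -> hdeg (p k) (1 - k%:Z)) -> homog 1 (gam m p).
Proof.
move=> Hp; elim=> [|s IH] [|t]; try exact: (hdeg0 HC).
  rewrite gam_s0; have -> : 1 + 0%:Z - s.+1%:Z = 1 - s.+1%:Z by lia.
  exact: Hp.
rewrite (gam_SS HC); have -> : 1 + t.+1%:Z - s.+1%:Z = 1 + t%:Z - s%:Z by lia.
apply: (hdegD HC); first exact/(hdegN HC)/(hdeg_tensm1 HC)/IH.
exact/(hdeg_sgn HC)/hdeg_insm.
Qed.

(* [X] tensored with the bar complex of [A]: this is [gam m 0], with the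
   positions of [A] shifted by one, which accounts for the extra sign. *)
Definition beta X : mat A X X := fun s t =>
  match s, t return Mor (bt A X s) (bt A X t) with
  | s'.+1, t'.+1 =>
      sgn (s' + t').+1
        (cmp (sigV A X t') (cmp (tensm (idm X) (gam m m s' t')) (sig A X s')))
  | _, _ => 0
  end.

Lemma beta_upper X s t : (s <= t)%N -> beta X s t = 0.
Proof.
case: s t => [|s] [|t] //= st.
by rewrite gam_upper // (tensmm0 HC) (cmp0m HC) (cmpm0 HC) sgn0.
Qed.

Lemma tri_beta X : tri (beta X).
Proof. by move=> s t /ltnW; exact: beta_upper. Qed.

(** Inserting [m] at the end commutes with isolating [X] in front, by the coherence
    [assoc_sig_spl]. *)
Lemma sig_insm X s t :
  cmp (sig A X t.+1) (insm m X s.+1 t.+1) =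
  cmp (tensm (idm X) (insm m A s t)) (sig A X s.+1).
Proof.
rewrite /insm ltnS subSS; case: ltnP => ts; last first.
  by rewrite (cmpm0 HC) (tensmm0 HC) (cmp0m HC).
have Hk := Hm.1 (s - t)%N; rewrite subn_gt0 in Hk; move/(_ ts): Hk => Hk.
rewrite [sig A X t.+1]/= -(Defs.compA HC) (Defs.compA HC (tensm (sig A X t) _)).
rewrite (cmp_tensm_m1_1m HC).
have -> : tensm (sig A X t) (m (s - t)%N) =
    cmp (tensm (idm (tens X (bt A A t))) (m (s - t)%N)) (tensm (sig A X t) (idm _)).
  by rewrite (cmp_tensm_1m_m1 HC Hk (hdeg_sig HC _ _ _)) mulr0.
rewrite -(Defs.compA HC) (Defs.compA HC (assoc _ _ _)) -(tensm11 HC X (bt A A t)) (assoc_nat HC).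
rewrite -(Defs.compA HC) (assoc_sig_spl HC) (Defs.compA HC).
by rewrite (tensm_1cmp HC _ _ (hdeg_1tensm HC _ Hk)).
Qed.

Lemma beta_SS X s t :
  beta X s.+1 t.+1 =
  - tensm (beta X s t) (idm A) + sgn (t.+1 * (s - t).+1)%N (insm m X s t).
Proof.
(* As [sig] is invertible, the two sides may be compared after composing with it. *)
suff E : cmp (sig A X t) (- tensm (beta X s t) (idm A) +
             sgn (t.+1 * (s - t).+1)%N (insm m X s t)) =
         sgn (s + t).+1 (cmp (tensm (idm X) (gam m m s t)) (sig A X s)).
  by rewrite /beta -(cmp_sgnr HC) -E (Defs.compA HC) (sigK HC) (comp1m HC).
rewrite (compDr HC) (cmpmN HC) (cmp_sgnr HC).
case: t => [|t].
  have -> : beta X s 0 = 0 by case: s.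
  rewrite (tensm0m HC) (cmpm0 HC) oppr0 add0r (comp1m HC) gam_s0 /insm.
  case: ltnP => s0; last by rewrite (tensmm0 HC) (cmp0m HC) !sgn0.
  rewrite subn0 mul1n addn0; congr (sgn _ (cmp _ _)).
  (* When the front block is [X] alone, [spl A X s 0 s] is [sig A X s]. *)
  by elim: s {s0} => [|s /= ->] //; exact: (tensm11 HC).
case: s => [|s].
  rewrite /= /insm [gam m m 0 _]gam_upper // (tensm0m HC) (tensmm0 HC).
  by rewrite !(cmpm0 HC) (cmp0m HC) !sgn0 oppr0 addr0.
rewrite sig_insm (gam_SS HC) (tensmDr HC) (compDl HC) sgnD; congr (_ + _).
  rewrite [beta _ _ _]/= (tensm_sgnl HC) (cmp_sgnr HC) (tensmmN HC) (cmpNm HC) sgnN.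
  rewrite addSn addnS !sgnS !opprK; congr (sgn _ _).
  rewrite [sig A X t.+1]/= -(Defs.compA HC).
  have HK : hdeg (cmp (tensm (idm X) (gam m m s t)) (sig A X s)) (1 + t%:Z - s%:Z).
    exact/(hdeg_cmpm0 HC _ (hdeg_sig HC _ _ _))/(hdeg_1tensm HC)/homog_gam/Hm.1.
  rewrite (tensm_cmp1 HC _ _ (hdeg_cmp0m HC (hdeg_sigV HC _ _ _) HK)).
  rewrite (Defs.compA HC (sig A X t)) (sigVK HC) (comp1m HC).
  rewrite -(tensm_cmp1 HC _ _ (hdeg_sig HC _ _ _)) (Defs.compA HC) (assoc_nat HC).
  by rewrite -(Defs.compA HC).
case: (leqP t s) => ts; last first.
  by rewrite /insm ltnNge (ltnW ts) sgn0 (tensmm0 HC) (cmp0m HC) !sgn0.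
rewrite (tensm_sgnr HC) (cmp_sgnl HC) sgn_add subSS; apply: sgn_eq.
rewrite -{2}(subnK ts) !(oddM, oddD, oddS).
by case: (odd (s - t)); case: (odd t).
Qed.

(** The component at 0 is replaced by 0: the Maurer-Cartan element has no constant term. *)
Definition pos X (p : forall k, Mor (bt A X k) X) : forall k, Mor (bt A X k) X :=
  fun k => match k return Mor (bt A X k) X with 0 => 0 | k'.+1 => p k'.+1 end.

(** Both sides obey the same recursion: [beta] carries the inhomogeneous term [insm], and a bar
    matrix of degree 1 obeys the homogeneous one. Thus the module structure enters only through a
    bar matrix. *)
Lemma gam_beta X (p : forall k, Mor (bt A X k) X) :
  gam m p = beta X + Bmor 1 (pos p) :> mat A X X.
Proof.
apply: matP; elim=> [|s IH] [|t]; rewrite mat_addE.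
- by rewrite gam_s0 Bmor_s0 addr0.
- by rewrite gam_upper // Bmor_upper // addr0.
- by rewrite gam_s0 Bmor_s0 add0r.
rewrite (gam_SS HC) IH mat_addE beta_SS (Bmor_SS HC) (tensmDl HC) opprD.
by rewrite addrAC.
Qed.

Lemma tri_gam X (p : forall k, Mor (bt A X k) X) : tri (gam m p).
Proof. by move=> s t /ltnW; exact: gam_upper. Qed.

Lemma twistedE X (p : forall k, Mor (bt A X k) X) :
  twisted (gam m p) <-> mdif (gam m p) + mmul (gam m p) (gam m p) = 0.
Proof.
split=> [E|E s t].
  by apply: matP => s t; rewrite mat_addE (mmulE HC _ _ _ (@tri_gam X p)); exact: E.
have /(congr1 (fun M : mat A X X => M s t)) := E.
by rewrite mat_addE (mmulE HC _ _ _ (@tri_gam X p)).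
Qed.

(** This is the A_oo-relation of [m], tensored with [X] and conjugated by [sig]; in each product the
    two inner regroupings cancel. *)
Lemma beta_mc X : mdif (beta X) + mmul (beta X) (beta X) = 0.
Proof.
apply: matP => s t; rewrite mat_addE (mmulE HC _ _ _ (@tri_beta X)).
case: t => [|t].
  rewrite big1 ?addr0; first by rewrite /mdif; case: s => *; rewrite (dif0 HC).
  by case=> [[|r] lt_r] _; rewrite /= (cmp0m HC).
case: s => [|s].
  by rewrite /mdif /= (dif0 HC) sgn0 big_ord1 (cmp0m HC) addr0.
rewrite big_ord_recl [beta X ord0 _]/= (cmp0m HC) add0r.
have E r : cmp (beta X r.+1 t.+1) (beta X s.+1 r.+1) =
    sgn (s + t) (cmp (sigV A X t)
      (cmp (tensm (idm X) (cmp (gam m m r t) (gam m m s r))) (sig A X s))).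
  have Hg := homog_gam Hm.1.
  rewrite /= (cmp_sgnl HC) (cmp_sgnr HC) sgn_add.
  rewrite -!(Defs.compA HC) (Defs.compA HC (sig A X r)) (sigVK HC) (comp1m HC).
  rewrite (Defs.compA HC (tensm _ _) (tensm _ _)) (tensm_1cmp HC _ _ (Hg _ _)).
  apply: sgn_eq; rewrite !(oddS, oddD).
  by case: odd; case: odd; case: odd.
rewrite (eq_bigr _ (fun (r : 'I_s.+1) _ => E r)) -sgn_sum.
rewrite -(cmp_sumr HC) -(cmp_suml HC) -(tensm_sumr HC).
have -> : mdif (beta X) s.+1 t.+1 = sgn (s + t) (cmp (sigV A X t)
      (cmp (tensm (idm X) (sgn t (dif (gam m m s t)))) (sig A X s))).
  rewrite /mdif /= (dif_sgn HC) (dif_cmp_closedl HC _ (hdeg_sigV HC _ _ _) (dif_sigV HC _ _ _)).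
  have Hg := hdeg_1tensm HC X (homog_gam Hm.1 s t).
  rewrite (dif_cmp_closedr HC Hg (dif_sig HC _ _ _)) (dif_tensm_1m HC).
  rewrite (tensm_sgnr HC) (cmp_sgnl HC) (cmp_sgnr HC) !sgn_add.
  by apply: sgn_eq; rewrite !(oddS, oddD); case: odd; case: odd.
rewrite -sgnD -(compDr HC) -(compDl HC) -(tensmDr HC) (Hm.2 s t).
by rewrite (tensmm0 HC) (cmp0m HC) (cmpm0 HC) sgn0.
Qed.

(** A strict map acts on [X] and [beta] on the letters behind it, so they commute up to the Koszul
    sign; [sig_diag] carries the strict map through the regrouping. *)
Lemma beta_strict X Y j (f : Mor X Y) : hdeg f j ->
  mmul (beta Y) (Bmor j (strict A f)) = sgni j (mmul (Bmor j (strict A f)) (beta X)).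
Proof.
move=> Hf; have off s t : s != t -> Bmor j (strict A f) s t = 0.
  by move=> st; rewrite (Bmor_strict HC) (diag_neq HC) // sgn0.
apply: matP => s t; rewrite /sgni mat_sgnE (mmul_diagr HC) // (mmul_diagl HC) //.
case: leqP => ts; last by rewrite sgn0.
case: s t ts => [|s] [|t] ts.
- by rewrite (cmp0m HC) (cmpm0 HC) sgn0.
- by rewrite (cmp0m HC) (cmpm0 HC) sgn0.
- by rewrite (cmp0m HC) (cmpm0 HC) sgn0.
rewrite !(Bmor_strict HC) /beta !(cmp_sgnr HC, cmp_sgnl HC) !sgn_add -!(Defs.compA HC).
rewrite (sig_diag HC A _ _ Hf).
have -> : cmp (diag A f t.+1 t.+1) (cmp (sigV A X t)
    (cmp (tensm (idm X) (gam m m s t)) (sig A X s))) =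
  cmp (sigV A Y t) (cmp (tensm f (gam m m s t)) (sig A X s)).
  rewrite -[diag _ _ _ _](comp1m HC) -(sigK HC) -!(Defs.compA HC).
  rewrite (Defs.compA HC (sig A Y t)) (sig_diag HC A _ _ Hf) -!(Defs.compA HC).
  rewrite (Defs.compA HC (sig A X t)) (sigVK HC) (comp1m HC) (diag_id HC).
  by rewrite (Defs.compA HC (tensm _ _) (tensm _ _)) (cmp_tensm_m1_1m HC).
rewrite (diag_id HC) (Defs.compA HC (tensm _ _) (tensm _ _)).
rewrite (cmp_tensm_1m_m1 HC (homog_gam Hm.1 s t) Hf) /sgni (cmp_sgnl HC) (cmp_sgnr HC) sgn_add.
apply: sgn_eq.
rewrite !(oddS, oddD, oddM) abszM oddM !odd_abszD abszN /=.
by case: (odd (absz j)); case: odd; case: odd.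
Qed.

End BarDifferential.

(** * Strictly triangular matrices and the geometric series *)

Section Neumann.
Variables (C : dgdata) (HC : dg_axioms C) (A X : Ob C).
Implicit Types K L M N P Z : mat A X X.

Definition strict_tri N := forall s t, (s <= t)%N -> N s t = 0.

Lemma strict_tri_mmul N M : strict_tri N -> strict_tri (mmul N M).
Proof.
move=> SN s t st; rewrite /mmul big1 // => r tr.
by rewrite SN ?(cmp0m HC) // (leq_trans _ st) // -ltnS.
Qed.

(** The entry of [mmul N Z] at [(s, t)] involves only entries [Z s r] with [t < r <= s], so all
    entries vanish by descending induction on [t]. Later identities follow by exhibiting a
    difference as such a fixed point. *)
Lemma fix_strict_tri N Z : strict_tri N -> Z = mmul N Z -> Z = 0.
Proof.
move=> SN E; apply: matP => s t.
suff /(_ s.+1) : forall d t, (s < t + d)%N -> Z s t = 0 by apply; lia.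
elim=> [|d IH] {}t std; rewrite E /mmul big1 // => r tr.
  by have := ltn_ord r; lia.
have [rt|] := leqP r t; first by rewrite SN ?(cmp0m HC).
by move=> rt; rewrite IH ?(cmpm0 HC) //; lia.
Qed.

Variables N M : mat A X X.

Fixpoint neumann_term n : mat A X X :=
  match n with 0 => M | n'.+1 => mmul N (neumann_term n') end.

(* The geometric series [M + N M + N N M + ...], truncated where its terms vanish. *)
Definition neumann : mat A X X := fun s t => \sum_(n < s) neumann_term n s t.

Hypotheses (SN : strict_tri N) (SM : strict_tri M).

(** The term is a product of [n + 1] factors, each of which strictly shortens the word. *)
Lemma neumann_term_upper n s t : (s <= t + n)%N -> neumann_term n s t = 0.
Proof.
elim: n t => [|n IH] t st; first by apply: SM; rewrite -[t]addn0.
rewrite /= /mmul big1 // => r tr; have [rt|rt] := leqP r t; first by rewrite SN ?(cmp0m HC).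
by rewrite IH ?(cmpm0 HC) //; lia.
Qed.

Lemma strict_tri_neumann : strict_tri neumann.
Proof. by move=> s t st; rewrite /neumann big1 // => n _; apply: neumann_term_upper; lia. Qed.

Lemma neumann_widen d s t : (s <= d)%N -> neumann s t = \sum_(n < d) neumann_term n s t.
Proof.
move=> sd; rewrite /neumann (big_ord_widen d (fun n => neumann_term n s t)) // big_mkcond.
apply: eq_bigr => n _; case: leqP => // sn.
by rewrite neumann_term_upper //; lia.
Qed.

Lemma neumannE : neumann = M + mmul N neumann.
Proof.
(* Extending the truncation from [s] to [s.+1] terms leaves room to split off the first term [M]. *)
apply: matP => s t; rewrite mat_addE (neumann_widen t (leqnSn s)) big_ord_recl; congr (_ + _).
rewrite [RHS]/mmul.
under [RHS]eq_bigr => r _ do rewrite (@neumann_widen s) -1?ltnS // (cmp_sumr HC).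
by rewrite exchange_big.
Qed.

Lemma bar_neumann j : bar 0 N -> bar j M -> bar j neumann.
Proof.
move=> BN BM; have BY n : bar j (neumann_term n).
  by elim: n => //= n; exact: (bar_mmul HC (esym (add0r j)) BN).
split=> [s t|t|s t]; first by apply: (hdeg_sum HC) => n _; exact: (bar_homog (BY n)).
  by rewrite /neumann big_ord0.
rewrite /neumann (tensm_suml HC) /sgni sgn_sum big_ord_recr /=.
(* Row [s.+1] has one more term than row [s]; it shortens the word at least [s.+1] times and cannot
   end at the positive length [t.+1]. *)
rewrite neumann_term_upper ?addr0; last by lia.
by apply: eq_bigr => n _; rewrite (bar_SS (BY n)).
Qed.

End Neumann.

(** * The differential twisted by a family of matrices *)

Section TwistedDifferential.
Variables (C : dgdata) (HC : dg_axioms C) (A : Ob C).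
Variable B : forall X, mat A X X.
Implicit Types X Y Z : Ob C.

(** The differential on morphisms of twisted complexes with components [B X] and [B Y]; it will be
    used with [B] equal to [beta m]. *)
Definition Dm X Y n (M : mat A X Y) : mat A X Y :=
  mdif M + mmul (B Y) M - sgni n (mmul M (B X)).

Lemma mmul_sgnl X Y Z n (M : mat A Y Z) (N : mat A X Y) :
  mmul (sgni n M) N = sgni n (mmul M N).
Proof. exact: (additive_sgn (fun M M' : mat A Y Z => mmulDl HC M M' N)). Qed.

Lemma mmul_sgnr X Y Z n (M : mat A Y Z) (N : mat A X Y) :
  mmul M (sgni n N) = sgni n (mmul M N).
Proof. exact: (additive_sgn (mmulDr HC M)). Qed.

Lemma mdifD X Y (M N : mat A X Y) : mdif (M + N) = mdif M + mdif N.
Proof.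
by apply: matP => s t; rewrite mat_addE /mdif -sgnD -(difD HC).
Qed.

Lemma DmD X Y n (M N : mat A X Y) : Dm n (M + N) = Dm n M + Dm n N.
Proof.
rewrite /Dm mdifD (mmulDr HC) (mmulDl HC) /sgni sgnD opprD.
by rewrite (addrACA (mdif M)) (addrACA (mdif M + _)).
Qed.

(** In the Leibniz rule the terms with [B Y] between [M] and [N], one from each factor, cancel. *)
Lemma Dm_mmul X Y Z i j k (M : mat A Y Z) (N : mat A X Y) : k = i + j -> homog i M ->
  Dm k (mmul M N) = mmul (Dm i M) N + sgni i (mmul M (Dm j N)).
Proof.
move=> -> HM; rewrite /Dm (mdif_mmul HC _ HM) !(mmulDl HC, mmulDr HC) (mmulNm HC) (mmulmN HC).
rewrite mmul_sgnl mmul_sgnr /sgni !sgnD sgnN !sgn_add !(mmulA HC).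
have -> : sgn (absz (i + j)) (mmul (mmul M N) (B X)) =
    sgn (absz i + absz j) (mmul (mmul M N) (B X)).
  by apply: sgn_eq; rewrite odd_abszD oddD.
rewrite -!addrA; congr (_ + _).
by rewrite [in RHS](addrCA (sgn _ (mmul M _)) (sgn _ _)) addKr addrCA.
Qed.

End TwistedDifferential.

(** * The perturbation formulas, as computations with matrices *)

Section Perturbation.
Variables (C : dgdata) (HC : dg_axioms C) (A : Ob C).
Variable B : forall X, mat A X X.
Variables (a b : Ob C).
Variables (P : mat A a a) (F : mat A a b) (G : mat A b a) (H X : mat A a a).
Local Notation "M ** N" := (mmul M N) (at level 40, left associativity).
Local Notation D := (Dm B).
Hypotheses (HF : homog 0 F) (HH : homog (-1) H).
Hypotheses (HP : homog 1 P) (HX : homog 1 X) (SP : strict_tri P) (TX : tri X).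
Hypotheses (DF : D 0 F = 0) (DG : D 0 G = 0) (DH : D (-1) H = G ** F - mone A a).
Hypothesis DP : D 1 P + P ** P = 0.
Hypothesis XE : X = P + P ** H ** X.

Local Notation GF := (G ** F).

Let PHX : P ** H ** X = X - P.
Proof. by rewrite [in RHS]XE [RHS]addrC addKr. Qed.

(** The difference of the two sides is fixed by left multiplication by [P ** H]. *)
Lemma perturbationEr : X = P + X ** H ** P.
Proof.
apply/eqP; rewrite -subr_eq0; apply/eqP.
apply: (fix_strict_tri HC (strict_tri_mmul HC H SP)).
rewrite opprD addrA !(mmulDr HC) !(mmulmN HC) !(mmulA HC) PHX.
rewrite !(mmulDl HC) !(mmulNm HC) [- (_ - _)]opprB addrA.
by rewrite subrK.
Qed.

(** Differentiating [X = P + P ** H ** X] gives a linear equation for [D 1 X], whose solution is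
    unique because [P ** H] is strictly triangular. *)
Lemma Dm_transfer : D 1 X = - (X ** GF ** X).
Proof.
have DPH : D 0 (P ** H) = - (P ** P ** H) - P ** GF + P.
  rewrite (@Dm_mmul C HC A B _ _ _ 1 (-1) 0 P H) // DH.
  have -> : D 1 P = - (P ** P) by apply/eqP; rewrite -subr_eq0 opprK DP.
  rewrite /sgni /sgn /= (mmulNm HC) (mmulDr HC) (mmulmN HC) (mmulm1 HC); last first.
    by move=> s t /ltnW; exact: SP.
  by rewrite opprB addrA addrAC.
(* The terms [- P ** P - P ** P ** H ** X + P ** X] cancel by the equation for [X]. *)
have DX : D 1 X = - (P ** GF ** X) + P ** H ** D 1 X.
  rewrite {1}XE (DmD HC) (@Dm_mmul C HC A B _ _ _ 0 1 1 (P ** H) X) //; last first.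
    by rewrite -[0](subrr 1); exact: homog_mmul.
  have -> : D 1 P = - (P ** P) by apply/eqP; rewrite -subr_eq0 opprK DP.
  rewrite DPH /sgni /sgn /= addrA; congr (_ + _).
  rewrite !(mmulDl HC) !(mmulNm HC) -!(mmulA HC) (mmulA HC P H X) PHX.
  rewrite (mmulDr HC) (mmulmN HC) opprB !addrA addNr add0r.
  by rewrite addrAC addNr add0r.
apply/eqP; rewrite -subr_eq0 opprK; apply/eqP.
apply: (fix_strict_tri HC (strict_tri_mmul HC H SP)).
rewrite {1}DX; move: (D 1 X) => W; rewrite (mmulDr HC) !(mmulA HC) PHX.
by rewrite !(mmulDl HC) !(mmulNm HC) addrC addrA addrC.
Qed.

Let Q := F ** X ** G.

(** As [F] and [G] are closed, [D 1 Q] is [F ** D 1 X ** G], which is [- Q ** Q] by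
    [Dm_transfer]. *)
Lemma transfer_mc : D 1 Q + Q ** Q = 0.
Proof.
have HFX : homog 1 (F ** X) by rewrite -[1]add0r; exact: homog_mmul.
rewrite (@Dm_mmul C HC A B _ _ _ 1 0 1 _ G) // DG (mmulm0 HC) /sgni sgn0 addr0.
rewrite (@Dm_mmul C HC A B _ _ _ 0 1 1 F X) // DF (mmul0m HC) add0r Dm_transfer.
by rewrite /sgni /sgn /= (mmulmN HC) (mmulNm HC) /Q !(mmulA HC) addNr.
Qed.

(** The product with [P] collapses to [F ** X] by [perturbationEr]; this is cancelled by the
    identity term of [D (-1) H]. *)
Lemma transfer_phi :
  D 0 (F + F ** X ** H) + Q ** (F + F ** X ** H) - (F + F ** X ** H) ** P = 0.
Proof.
have HFX : homog 1 (F ** X) by rewrite -[1]add0r; exact: homog_mmul.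
rewrite (DmD HC) DF add0r (@Dm_mmul C HC A B _ _ _ 1 (-1) 0 _ H) // DH.
rewrite (@Dm_mmul C HC A B _ _ _ 0 1 1 F X) // DF (mmul0m HC) add0r Dm_transfer.
rewrite /sgni /sgn /= !(mmulDl HC, mmulDr HC) !(mmulmN HC, mmulNm HC) !(mmulA HC).
rewrite (mmulm1 HC); last exact: tri_mmul.
have E : F ** P + F ** X ** H ** P = F ** X.
  by rewrite -!(mmulA HC) -(mmulDr HC) (mmulA HC X) -perturbationEr.
rewrite E /Q -opprD [_ + (_ - F ** X)]addrA opprB.
by rewrite [_ + F ** X ** G ** F ** X ** H]addrC subrK subrr.
Qed.

Let DHX : D 0 (H ** X) = GF ** X - X + H ** X ** GF ** X.
Proof.
rewrite (@Dm_mmul C HC A B _ _ _ (-1) 1 0 H X) // DH Dm_transfer /sgni /sgn /=.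
by rewrite (mmulDl HC) (mmulNm HC) (mmul1m HC) // (mmulmN HC) opprK !(mmulA HC).
Qed.

Let homog_HX : homog 0 (H ** X).
Proof. by rewrite -[0](addNr 1); exact: homog_mmul. Qed.

Lemma transfer_psi :
  D 0 (G + H ** X ** G) + P ** (G + H ** X ** G) - (G + H ** X ** G) ** Q = 0.
Proof.
rewrite (DmD HC) DG add0r (@Dm_mmul C HC A B _ _ _ 0 0 0 _ G) // DG DHX.
rewrite (mmulm0 HC) /sgni sgn0 addr0 !(mmulDl HC, mmulDr HC) !(mmulNm HC).
rewrite !(mmulA HC) PHX (mmulDl HC) (mmulNm HC) [_ + (_ - P ** G)]addrC subrK.
by rewrite [_ - X ** G + _]addrAC subrK subrr.
Qed.

(** The two forms of the equation for [X] reduce [P ** K + K ** P] to [X ** H + H ** X], which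
    cancels the contributions to [D (-1) K] of the identity in [D (-1) H] and of [- X] in the
    differential of [H ** X]. *)
Lemma transfer_homotopy : let K := H + H ** X ** H in
  (G + H ** X ** G) ** (F + F ** X ** H) = mone A a + (D (-1) K + P ** K + K ** P).
Proof.
rewrite /= (DmD HC) DH (@Dm_mmul C HC A B _ _ _ 0 (-1) (-1) _ H) // DHX DH.
rewrite /sgni /sgn /= !(mmulDl HC, mmulDr HC) !(mmulmN HC, mmulNm HC) !(mmulA HC).
rewrite (mmulm1 HC); last exact: tri_mmul.
have -> : H ** P + H ** X ** H ** P = H ** X.
  by rewrite -!(mmulA HC) -(mmulDr HC) (mmulA HC X) -perturbationEr.
have -> : P ** H + P ** H ** X ** H = X ** H.
  by rewrite PHX (mmulDl HC) (mmulNm HC) addrC subrK.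
move: (mone A a) (X ** H) (H ** X) => e z u.
rewrite -!addrA [RHS]addrCA addNKr; congr (_ + (_ + _)).
by rewrite [z + u]addrC addKr [RHS]addrCA [X in _ + (- z + X)]addrC addKr addrC.
Qed.

End Perturbation.

(** * From matrices back to modules and their morphisms *)

Section Transfer.
Variables (C : dgdata) (HC : dg_axioms C) (A : Ob C).
Variable m : forall k, Mor (bt A A k) A.
Hypothesis Hm : is_Ainf_alg m.
Implicit Types X Y : Ob C.

Local Notation D := (Dm (beta m)).

(** By [beta_strict] the [beta] terms cancel, and only the entrywise differential remains. *)
Lemma Dm_strict X Y (i j : int) (f : Mor X Y) : j = i + 1 -> hdeg f i ->
  D i (Bmor i (strict A f)) = Bmor j (strict A (dif f)).
Proof.
move=> -> Hf; rewrite /Dm (beta_strict HC Hm Hf) addrK.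
have Bf := bar_strict HC A Hf.
have Bd := bar_mdif HC (erefl (i + 1)) Bf.
have Bdf := bar_strict HC A (hdeg_dif HC Hf).
apply: (bar_ext Bd Bdf) => -[|s].
- by rewrite /mdif !Bmor_s0.
- by rewrite /mdif !Bmor_s0 /= (dif0 HC).
Qed.

Lemma Dm_strict_closed X Y (i : int) (f : Mor X Y) : hdeg f i -> dif f = 0 ->
  D i (Bmor i (strict A f)) = 0.
Proof.
move=> Hf df; rewrite (Dm_strict (erefl _) Hf) df.
have B0 := bar_strict HC A (hdeg0 HC X Y (i + 1)).
by apply: (bar_ext B0 (bar0 HC A X Y (i + 1))) => -[|s]; rewrite Bmor_s0.
Qed.

Lemma strict_tri_pos X (p : forall k, Mor (bt A X k) X) : strict_tri (Bmor 1 (pos p)).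
Proof.
elim=> [|s IH] [|t] st //; first by rewrite Bmor_s0.
by rewrite (Bmor_SS HC) IH // (tensm0m HC) /sgni sgn0.
Qed.

Lemma bar_pos X (p : forall k, Mor (bt A X k) X) :
  (forall k, (0 < k)%N -> hdeg (p k) (1 - k%:Z)) -> bar 1 (Bmor 1 (pos p)).
Proof.
by move=> Hp; apply: (bar_Bmor HC) => -[|k]; [exact: (hdeg0 HC)|exact: Hp].
Qed.

(** Expanding [beta m X + P], the terms in [beta] alone vanish by [beta_mc], and the mixed ones
    complete [mdif P] to [D 1 P]. *)
Lemma twisted_mc X (p : forall k, Mor (bt A X k) X) (P := Bmor 1 (pos p) : mat A X X) :
  twisted (gam m p) <-> D 1 P + mmul P P = 0.
Proof.
rewrite (twistedE HC) (gam_beta HC Hm) -/P.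
suff -> : mdif (beta m X + P) + mmul (beta m X + P) (beta m X + P) =
    D 1 P + mmul P P by [].
rewrite (mdifD HC) !(mmulDl HC, mmulDr HC) /Dm /sgni /sgn /= opprK.
by rewrite -[_ + mmul (beta m X) P + _]addrA addrACA (beta_mc HC Hm) add0r !addrA.
Qed.

(** Splitting both bar differentials by [gam_beta] yields the form in which the perturbation
    formulas are stated. *)
Lemma dTw_Dm X Y (p : forall k, Mor (bt A X k) X) (q : forall k, Mor (bt A Y k) Y)
    n (M : mat A X Y) s t : tri M ->
  dTw (gam m p) (gam m q) n M s t =
  (D n M + mmul (Bmor 1 (pos q)) M - sgni n (mmul M (Bmor 1 (pos p)))) s t.
Proof.
move=> TM; have -> : dTw (gam m p) (gam m q) n M s t =
    (mdif M + mmul (gam m q) M - sgni n (mmul M (gam m p))) s t.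
  rewrite !mat_addE mat_oppE /sgni mat_sgnE !(mmulE HC) //; exact: tri_gam.
congr (_ s t); rewrite !(gam_beta HC Hm) (mmulDl HC) (mmulDr HC) /Dm /sgni sgnD opprD.
by rewrite (addrA (mdif M)) addrACA addrA.
Qed.

Lemma mmul00 X Y Z (M : mat A Y Z) (N : mat A X Y) :
  mmul M N 0%N 0%N = cmp (M 0%N 0%N) (N 0%N 0%N).
Proof. by rewrite /mmul big_mkcond big_ord1. Qed.

End Transfer.

Theorem theoremA2 (C : dgdata) (HC : dg_axioms C)
  (A : Ob C) (m : forall k : nat, Mor (bt A A k) A) (Hm : is_Ainf_alg m)
  (a : Ob C) (p : forall k : nat, Mor (bt A a k) a) (Hp : is_module m p)
  (b : Ob C) (f : Mor a b) (g : Mor b a) (h : Mor a a)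
  (Hf : hdeg f 0 /\ dif f = 0) (Hg : hdeg g 0 /\ dif g = 0) (Hh : hdeg h (-1))
  (Hgf : cmp g f = idm a + dif h) :
  exists (q : forall k : nat, Mor (bt A b k) b)
         (phi : forall k : nat, Mor (bt A a k) b)
         (psi : forall k : nat, Mor (bt A b k) a)
         (H : forall k : nat, Mor (bt A a k) a),
    is_module m q /\
    (modmor_deg 0 phi /\ (forall k, dMod m p q 0 phi k = 0) /\ phi 0%N = f) /\
    (modmor_deg 0 psi /\ (forall k, dMod m q p 0 psi k = 0) /\ psi 0%N = g) /\
    (modmor_deg (-1) H /\ H 0%N = h) /\
    (forall k : nat, compMod 0 0 psi phi k = idMod A a k + dMod m p p (-1) H k).
Proof.
case: Hf Hg => Hf df [Hg dg].
pose P := Bmor 1 (pos p) : mat A a a.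
pose F := Bmor 0 (strict A f) : mat A a b.
pose G := Bmor 0 (strict A g) : mat A b a.
pose H := Bmor (-1) (strict A h) : mat A a a.
have BP : bar 1 P := bar_pos HC Hp.1.
have BF : bar 0 F := bar_strict HC A Hf.
have BG : bar 0 G := bar_strict HC A Hg.
have BH : bar (-1) H := bar_strict HC A Hh.
have SP : strict_tri P := strict_tri_pos HC p.
have DP : Dm (beta m) 1 P + mmul P P = 0 by apply/(twisted_mc HC Hm); exact: Hp.2.
have DF : Dm (beta m) 0 F = 0 := Dm_strict_closed HC Hm Hf df.
have DG : Dm (beta m) 0 G = 0 := Dm_strict_closed HC Hm Hg dg.
(* The relation [Hgf] lifts to bar matrices of degree 0, so it suffices to compare entries into
   position 0; these vanish for [s > 0] since all maps are strict. *)
have DH : Dm (beta m) (-1) H = mmul G F - mone A a.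
  rewrite (@Dm_strict C HC A m Hm _ _ (-1) 0) //.
  apply/eqP; rewrite eq_sym subr_eq addrC; apply/eqP.
  have Bdh : bar 0 (Bmor 0 (strict A (dif h))).
    by apply: (bar_strict HC); rewrite -[0](addNr 1); exact: (hdeg_dif HC).
  apply: (bar_ext (bar_mmul HC _ BG BF) (barD HC (bar_mone HC A a) Bdh)) => // s.
  rewrite mat_addE (mmul_diagr HC) //; last first.
    by move=> i j ij; rewrite /F (Bmor_strict HC) (diag_neq HC) // sgn0.
  rewrite /G /F !Bmor_s0; case: s => [|s]; first by rewrite Bmor_s0 -Hgf.
  by rewrite (cmp0m HC) addr0.
have SN : strict_tri (mmul P H) := strict_tri_mmul HC H SP.
pose X := neumann (mmul P H) P.
have XE : X = P + mmul (mmul P H) X := neumannE HC SN SP.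
have BX : bar 1 X := bar_neumann HC SN SP (bar_mmul HC (esym (subrr 1)) BP BH) BP.
(* This forces the first components of [Phi], [Psi] and [K] to be exactly [f], [g] and [h]. *)
have X00 : X 0%N 0%N = 0 by apply: strict_tri_neumann.
pose Q := mmul (mmul F X) G.
pose Phi := F + mmul (mmul F X) H.
pose Psi := G + mmul (mmul H X) G.
pose K := H + mmul (mmul H X) H.
have BFX : bar 1 (mmul F X) := bar_mmul HC (esym (add0r 1)) BF BX.
have BHX : bar 0 (mmul H X) := bar_mmul HC (esym (addNr 1)) BH BX.
have BQ : bar 1 Q := bar_mmul HC (esym (addr0 1)) BFX BG.
have BPhi : bar 0 Phi := barD HC BF (bar_mmul HC (esym (subrr 1)) BFX BH).
have BPsi : bar 0 Psi := barD HC BG (bar_mmul HC (esym (addr0 0)) BHX BG).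
have BK : bar (-1) K := barD HC BH (bar_mmul HC (esym (add0r (-1))) BHX BH).
have deg0 Y Z j (M : mat A Y Z) : bar j M -> modmor_deg j (fun k => M k 0%N).
  by move=> BM k; have := bar_homog BM k 0%N; rewrite addr0.
(* Because [Q] has no constant term either, [pos] leaves its family of components unchanged. *)
have EQ : Bmor 1 (pos (fun k => Q k 0%N)) = Q.
  rewrite [RHS](bar_eq_Bmor HC BQ); apply: (bar_ext (j := 1)) => [||[|s]]; rewrite ?Bmor_s0 //.
  - by apply: (bar_pos HC) => k _; exact: deg0.
  - by apply: (bar_Bmor HC); exact: deg0.
  - by rewrite /Q !mmul00 X00 (cmpm0 HC) (cmp0m HC).
have EPhi := bar_eq_Bmor HC BPhi.
have EPsi := bar_eq_Bmor HC BPsi.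
have EK := bar_eq_Bmor HC BK.
exists (fun k => Q k 0%N), (fun k => Phi k 0%N), (fun k => Psi k 0%N), (fun k => K k 0%N).
have [hF hH] := conj (bar_homog BF) (bar_homog BH).
have [hP hX tX] := And3 (bar_homog BP) (bar_homog BX) (bar_tri HC BX).
split; [|split; [|split; [|split]]].
- split; first by move=> k _; exact: deg0.
  apply/(twisted_mc HC Hm); rewrite EQ.
  exact: (transfer_mc HC hF hH hP hX SP DF DG DH DP XE).
- split; first exact: deg0.
  split=> [k|]; last by rewrite /Phi mat_addE !mmul00 X00 (cmpm0 HC) (cmp0m HC) addr0 /F Bmor_s0.
  rewrite /dMod -EPhi (dTw_Dm HC Hm) ?EQ; last exact: (bar_tri HC BPhi).
  (* The module differential is read off in column 0 of this matrix identity. *)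
  have E : Dm (beta m) 0 Phi + mmul Q Phi - mmul Phi P = 0.
    exact: (transfer_phi HC hF hH hP hX SP DF DH DP XE).
  exact: (congr1 (fun M : mat A a b => M k 0%N) E).
- split; first exact: deg0.
  split=> [k|]; last by rewrite /Psi mat_addE !mmul00 X00 (cmpm0 HC) (cmp0m HC) addr0 /G Bmor_s0.
  rewrite /dMod -EPsi (dTw_Dm HC Hm) ?EQ; last exact: (bar_tri HC BPsi).
  have E : Dm (beta m) 0 Psi + mmul P Psi - mmul Psi Q = 0.
    exact: (transfer_psi HC hH hP hX SP tX DG DH DP XE).
  exact: (congr1 (fun M : mat A b a => M k 0%N) E).
- split; first exact: deg0.
  by rewrite /K mat_addE !mmul00 X00 (cmpm0 HC) (cmp0m HC) addr0 /H Bmor_s0.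
move=> k; rewrite /compMod /dMod -EPhi -EPsi -EK (dTw_Dm HC Hm); last exact: (bar_tri HC BK).
have E : mmul Psi Phi = mone A a + (Dm (beta m) (-1) K + mmul P K + mmul K P).
  exact: (transfer_homotopy HC hH hP hX SP tX DH DP XE).
have -> : idMod A a k = mone A a k 0%N by case: k.
(* In degree -1 the sign in the differential turns the subtraction of [mmul K P] into an
   addition. *)
rewrite -[_ - _]/(Dm (beta m) (-1) K + mmul P K - - mmul K P) opprK.
exact: (congr1 (fun M : mat A a a => M k 0%N) E).
Qed.
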